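(* Let $\Gamma$ be a countable left-orderable virtually solvable group of infinite rank. Then $\mathcal{LO}(\Gamma)$ is homeomorphic to a Cantor set.
   Context: A left-ordering on a group $G$ is a total order $\preceq$ on $G$ such that $f\preceq g$ implies $hf\preceq hg$ for all $f,g,h\in G$; $G$ is left-orderable if it admits a left-ordering. The space $\mathcal{LO}(G)$ is the set of all left-orderings of $G$, with the topology having as a basis the sets $V_{f_1,\dots,f_k}=\{\preceq \;\mid\; id\preceq f_1,\dots, id\preceq f_k\}$, where $\{f_1,\dots,f_k\}$ runs over the finite subsets of $G$. A solvable group has finite rank if all successive quotients $A$ of its derived series have finite rank as Abelian groups (i.e. $\dim_{\mathbb{Q}}(A\otimes\mathbb{Q})<\infty$), and infinite rank otherwise. A virtually solvable group is said to have infinite rank if it has a finite-index solvable subgroup of infinite rank. *)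

(* Defs.v *)
From HB Require Import structures.
From mathcomp Require Import all_boot all_algebra finmap.
From mathcomp Require Import all_classical.
From mathcomp Require Import topology cantor freeg.

Set Implicit Arguments.
Unset Strict Implicit.
Unset Printing Implicit Defensive.

Import GRing.Theory.

Local Open Scope classical_set_scope.
Local Open Scope quotient_scope.
Local Open Scope group_scope.

(* Subgroups of G : groupType are the predicates H : groupClosed G. *)

Definition left_coset (G : groupType) (H : groupClosed G) (x : G) : set G :=
  [set y | x^-1 * y \in H].

Definition finite_index (G : groupType) (H : groupClosed G) : Prop :=
  finite_set [set left_coset H x | x in [set: G]].

(* The subgroup generated by the commutators of H, as the intersection of all
   the subgroups that contain them. *)
Definition commutator_pred (G : groupType) (H : groupClosed G) : {pred G} :=
  fun z => `[< forall K : groupClosed G,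
    (forall x y, x \in H -> y \in H -> [~ x, y] \in K) -> z \in K >].

Section CommutatorSubgroup.
Variables (G : groupType) (H : groupClosed G).

Lemma commutatorP z :
  reflect (forall K : groupClosed G,
    (forall x y, x \in H -> y \in H -> [~ x, y] \in K) -> z \in K)
    (z \in commutator_pred H).
Proof. exact: asboolP. Qed.

Lemma commutator1 : 1 \in commutator_pred H.
Proof. by apply/commutatorP => K _; exact: gpred1. Qed.

Lemma commutatorM : mulg_closed (commutator_pred H).
Proof.
move=> x y /commutatorP Hx /commutatorP Hy; apply/commutatorP => K HK.
by apply: gpredM; [exact: Hx | exact: Hy].
Qed.

Lemma commutatorV : invg_closed (commutator_pred H).
Proof.
move=> x /commutatorP Hx; apply/commutatorP => K HK.
by apply: gpredVr; exact: Hx.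
Qed.

HB.instance Definition _ := isMulClosed.Build G (commutator_pred H) commutatorM.
HB.instance Definition _ := isMul1Closed.Build G (commutator_pred H) commutator1.
HB.instance Definition _ := isInvClosed.Build G (commutator_pred H) commutatorV.

Definition commutator_subgroup : groupClosed G := commutator_pred H.

Lemma mem_commutator x y :
  x \in H -> y \in H -> [~ x, y] \in commutator_subgroup.
Proof. by move=> Hx Hy; apply/commutatorP => K; apply. Qed.

Lemma commutator_sub x : x \in commutator_subgroup -> x \in H.
Proof.
move=> /commutatorP; apply => a b Ha Hb.
by rewrite /commg /conjg !gpredM ?gpredV.
Qed.

End CommutatorSubgroup.

Fixpoint derived_series (G : groupType) (H : groupClosed G) (n : nat) :
    groupClosed G :=
  if n is m.+1 then commutator_subgroup (derived_series H m) else H.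

Definition solvable_subgroup (G : groupType) (H : groupClosed G) : Prop :=
  exists n, forall x, x \in derived_series H n -> x = 1.

Definition sub_of (G : groupType) (H : groupClosed G) : Type := {x : G | x \in H}.

Section Abelianization.
Variables (G : groupType) (H : groupClosed G).

HB.instance Definition _ := SubChoice.on (sub_of H).

Lemma sub_of_closed : group_closed (H : {pred G}).
Proof. by split; [exact: gpred1 | exact: gpredF]. Qed.

HB.instance Definition _ :=
  SubChoice_isSubGroup.Build G (fun x => x \in H) (sub_of H) sub_of_closed.

Definition abel_rel : rel (sub_of H) :=
  fun x y => val (x^-1 * y) \in commutator_subgroup H.

Lemma abel_rel_refl : reflexive abel_rel.
Proof. by move=> x; rewrite /abel_rel mulVg val1 gpred1. Qed.

Lemma abel_rel_sym : symmetric abel_rel.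
Proof. by move=> x y; rewrite /abel_rel -gpredV -gmulfV invgM invgK. Qed.

Lemma abel_rel_trans : transitive abel_rel.
Proof.
move=> y x z; rewrite /abel_rel => xy yz.
by have := gpredM _ _ xy yz; rewrite -valM -mulgA mulVKg.
Qed.


Canonical abel_equiv :=
  EquivRel abel_rel abel_rel_refl abel_rel_sym abel_rel_trans.

(* The quotient H / [H, H], with additive notation for its group law below. *)
Definition abelianization : Type := {eq_quot abel_equiv}.

HB.instance Definition _ := Choice.on abelianization.
HB.instance Definition _ := EqQuotient.on abelianization.

Lemma abel_relM x x' y y' :
  abel_rel x x' -> abel_rel y y' -> abel_rel (x * y) (x' * y').
Proof.
rewrite /abel_rel => xx' yy'.
set c := x^-1 * x' in xx'.
have -> : (x * y)^-1 * (x' * y') = c * [~ c, y] * (y^-1 * y').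
  rewrite /commg /conjg !mulgA mulgV mul1g invgM -!mulgA.
  by rewrite (mulgA y y^-1) mulgV mul1g.
rewrite valM gpredM// valM gpredM// gmulfR.
by apply: mem_commutator; exact: valP.
Qed.

Lemma abel_relV x x' : abel_rel x x' -> abel_rel x^-1 x'^-1.
Proof.
move=> xx'; have /(abel_relM xx') := abel_rel_refl x^-1.
have := abel_relM (abel_rel_refl x'^-1) (abel_relM xx' (abel_rel_refl x^-1)).
by rewrite !mulgV mulg1 mulKg abel_rel_sym.
Qed.

Lemma abel_relC x y : abel_rel (x * y) (y * x).
Proof.
rewrite /abel_rel.
have -> : (x * y)^-1 * (y * x) = [~ y, x].
  by rewrite /commg /conjg invgM !mulgA.
by rewrite gmulfR; apply: mem_commutator; exact: valP.
Qed.

Definition abel_zero : abelianization := \pi_abelianization 1.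
Definition abel_add : abelianization -> abelianization -> abelianization :=
  fun a b => \pi_abelianization (repr a * repr b).
Definition abel_opp : abelianization -> abelianization :=
  fun a => \pi_abelianization ((repr a)^-1).

Lemma abel_repr x : abel_rel (repr (\pi_abelianization x)) x.
Proof. by have /eqmodP := reprK (\pi_abelianization x). Qed.

Lemma pi_abel_add x y :
  abel_add (\pi x) (\pi y) = \pi_abelianization (x * y).
Proof. by apply/eqmodP; apply: abel_relM; exact: abel_repr. Qed.

Lemma pi_abel_opp x : abel_opp (\pi x) = \pi_abelianization x^-1.
Proof. by apply/eqmodP; apply: abel_relV; exact: abel_repr. Qed.

Lemma abel_addA : associative abel_add.
Proof.
by elim/quotW=> x; elim/quotW=> y; elim/quotW=> z; rewrite !pi_abel_add mulgA.
Qed.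

Lemma abel_addC : commutative abel_add.
Proof.
elim/quotW=> x; elim/quotW=> y; rewrite !pi_abel_add.
by apply/eqmodP; exact: abel_relC.
Qed.

Lemma abel_add0 : left_id abel_zero abel_add.
Proof. by elim/quotW=> x; rewrite pi_abel_add mul1g. Qed.

Lemma abel_addN : left_inverse abel_zero abel_opp abel_add.
Proof. by elim/quotW=> x; rewrite pi_abel_opp pi_abel_add mulVg. Qed.

HB.instance Definition _ :=
  GRing.isZmodule.Build abelianization abel_addA abel_addC abel_add0 abel_addN.

End Abelianization.

Section Tensor.
Variables A B : zmodType.
Local Open Scope ring_scope.

Definition tensor_free := {freeg (A * B)%type / int}.

HB.instance Definition _ := GRing.Lmodule.on tensor_free.

Definition bilinear_closed (S : {pred tensor_free}) : Prop :=
  [/\ GRing.zmod_closed S,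
      forall a a' b, << (a + a', b) >> - << (a, b) >> - << (a', b) >> \in S &
      forall a b b', << (a, b + b') >> - << (a, b) >> - << (a, b') >> \in S].

(* The subgroup generated by the bilinearity relations: tensor is the textbook
   quotient of the free abelian group on A * B by it. *)
Definition bilinear_pred : {pred tensor_free} :=
  fun D => `[< forall S : {pred tensor_free}, bilinear_closed S -> D \in S >].

Lemma bilinear_predP D :
  reflect (forall S : {pred tensor_free}, bilinear_closed S -> D \in S)
    (D \in bilinear_pred).
Proof. exact: asboolP. Qed.

Lemma bilinear_zmod_closed : GRing.zmod_closed bilinear_pred.
Proof.
split=> [|x y /bilinear_predP Sx /bilinear_predP Sy]; apply/bilinear_predP.
  by move=> S [[]].
by move=> S HS; case: (HS) => -[_ SB] _ _; apply: SB; [exact: Sx | exact: Sy].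
Qed.

HB.instance Definition _ :=
  GRing.isZmodClosed.Build tensor_free bilinear_pred bilinear_zmod_closed.

Definition tensor : Type := @Quotient.quot tensor_free bilinear_pred.

HB.instance Definition _ := GRing.Zmodule.on tensor.
HB.instance Definition _ := EqQuotient.on tensor.

Definition pure_tensor (a : A) (b : B) : tensor := \pi_tensor << (a, b) >>.

Lemma pi_tensorB (D E : tensor_free) :
  \pi_tensor (D - E) = \pi_tensor D - \pi_tensor E.
Proof. by rewrite -[RHS]/(\pi_tensor D + - \pi_tensor E) !piE. Qed.

Lemma tensor_freeW (P : tensor_free -> Prop) :
    P 0 -> (forall D E, P D -> P E -> P (D - E)) ->
    (forall a b, P << (a, b) >>) ->
  forall D, P D.
Proof.
move=> P0 PB Pgen D.
have PN E : P E -> P (- E) by move=> PE; rewrite -sub0r; exact: PB.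
have PD E F : P E -> P F -> P (E + F).
  by move=> PE PF; rewrite -[F]opprK; apply: PB => //; exact: PN.
have PMn E n : P E -> P (E *+ n).
  by move=> PE; elim: n => [|n IHn]; rewrite ?mulr0n// mulrS; exact: PD.
rewrite -(freeg_sumE D); elim/big_ind : _ => // -[a b] _.
rewrite -[coeff _ _]intz -freegU_mulz.
case: (coeff _ _) => n; rewrite ?NegzE ?mulrNz -?pmulrn; last apply: PN.
  exact: PMn.
exact: PMn.
Qed.

Lemma tensorW (P : tensor -> Prop) :
    P 0 -> (forall u v, P u -> P v -> P (u - v)) ->
    (forall a b, P (pure_tensor a b)) ->
  forall u, P u.
Proof.
move=> P0 PB Ppure; elim/quotW.
apply: (tensor_freeW (P := fun D => P (\pi_tensor D))) => [|D E PD PE|//].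
  by rewrite -(subrr (0 : tensor_free)) pi_tensorB subrr.
by rewrite pi_tensorB; exact: PB.
Qed.

Lemma pi_tensor0 D : D \in bilinear_pred -> \pi_tensor D = 0.
Proof.
move=> DI; rewrite -[RHS](subrr (\pi_tensor 0)) -pi_tensorB.
by apply/eqP; rewrite -Quotient.idealrBE subrr subr0.
Qed.

Lemma pure_tensorDl a a' b :
  pure_tensor (a + a') b = pure_tensor a b + pure_tensor a' b.
Proof.
apply/eqP; rewrite -subr_eq0 opprD addrA -!pi_tensorB pi_tensor0//.
by apply/bilinear_predP => S [].
Qed.

Lemma pure_tensorDr a b b' :
  pure_tensor a (b + b') = pure_tensor a b + pure_tensor a b'.
Proof.
apply/eqP; rewrite -subr_eq0 opprD addrA -!pi_tensorB pi_tensor0//.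
by apply/bilinear_predP => S [].
Qed.

End Tensor.

Section TensorRat.
Variable A : zmodType.
Local Open Scope ring_scope.
Local Notation F := (tensor_free A rat).
Local Notation V := (tensor A rat).

Definition scale_free (c : rat) : F -> F :=
  fglift (fun p : A * rat => << (p.1, c * p.2) >> : F).

Lemma scale_freeB c : {morph scale_free c : D E / D - E}.
Proof. exact: lift_is_additive. Qed.

Lemma scale_freeU c a q : scale_free c << (a, q) >> = << (a, c * q) >>.
Proof. by rewrite /scale_free liftU scale1r. Qed.

Lemma scale_free_bilinear c D :
  D \in @bilinear_pred A rat -> scale_free c D \in @bilinear_pred A rat.
Proof.
move=> /bilinear_predP HD; apply/bilinear_predP => S HS.
have [[S0 SB] Sl Sr] := HS.
apply: (HD [pred E | scale_free c E \in S]); split=> [|a a' b|a b b'].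
- split=> [|x y]; rewrite !inE.
    by rewrite -(subrr (0 : F)) scale_freeB subrr.
  by rewrite scale_freeB; exact: SB.
- by rewrite inE !scale_freeB !scale_freeU.
- by rewrite inE !scale_freeB !scale_freeU mulrDr.
Qed.

Definition scale_tensor (c : rat) (u : V) : V := \pi_V (scale_free c (repr u)).

Lemma pi_scale_tensor c D : scale_tensor c (\pi_V D) = \pi_V (scale_free c D).
Proof.
apply/eqP; rewrite -subr_eq0 -pi_tensorB -scale_freeB pi_tensor0//.
by apply: scale_free_bilinear; rewrite Quotient.idealrBE reprK.
Qed.

Lemma scale_pure c a q : scale_tensor c (pure_tensor a q) = pure_tensor a (c * q).
Proof. by rewrite pi_scale_tensor scale_freeU. Qed.

Lemma scale_tensorB c : {morph scale_tensor c : u v / u - v}.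
Proof.
elim/quotW=> D; elim/quotW=> E.
by rewrite -pi_tensorB !pi_scale_tensor scale_freeB pi_tensorB.
Qed.

Lemma scale_tensor0 c : scale_tensor c 0 = 0.
Proof. by rewrite -[in LHS](subrr 0) scale_tensorB subrr. Qed.

Lemma scale_tensorDr : right_distributive scale_tensor +%R.
Proof.
move=> c u v; rewrite -[v in LHS]opprK scale_tensorB -[- v]sub0r.
by rewrite scale_tensorB scale_tensor0 sub0r opprK.
Qed.

Lemma scale_tensorA c d u :
  scale_tensor c (scale_tensor d u) = scale_tensor (c * d) u.
Proof.
elim/tensorW: u => [|u v IHu IHv|a q]; first by rewrite !scale_tensor0.
  by rewrite !scale_tensorB IHu IHv.
by rewrite !scale_pure mulrA.
Qed.

Lemma scale_tensor1 : left_id 1 scale_tensor.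
Proof.
elim/tensorW=> [|u v IHu IHv|a q]; first by rewrite scale_tensor0.
  by rewrite scale_tensorB IHu IHv.
by rewrite scale_pure mul1r.
Qed.

Lemma scale_tensorDl u : {morph scale_tensor^~ u : c d / c + d}.
Proof.
move=> c d; elim/tensorW: u => [|u v IHu IHv|a q].
- by rewrite !scale_tensor0 addr0.
- by rewrite !scale_tensorB IHu IHv opprD addrACA.
- by rewrite !scale_pure mulrDl pure_tensorDr.
Qed.

HB.instance Definition _ := GRing.Zmodule_isLmodule.Build rat V
  scale_tensorA scale_tensor1 scale_tensorDr scale_tensorDl.

End TensorRat.

(* Vector.axiom n V is the type of linear isomorphisms from V to 'rV[K]_n. *)
Definition finite_dim (K : fieldType) (V : lmodType K) : Prop :=
  exists n, inhabited (Vector.axiom n V).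

Definition finite_rank (A : zmodType) : Prop := finite_dim (tensor A rat).

(* By definition of derived_series, abelianization (derived_series H n) is the
   n-th successive quotient of the derived series of H. *)
Definition solvable_finite_rank (G : groupType) (H : groupClosed G) : Prop :=
  forall n, finite_rank (abelianization (derived_series H n)).

Definition virtually_solvable (G : groupType) : Prop :=
  exists H : groupClosed G, finite_index H /\ solvable_subgroup H.

Definition infinite_rank (G : groupType) : Prop :=
  exists H : groupClosed G,
    [/\ finite_index H, solvable_subgroup H & ~ solvable_finite_rank H].

Record left_ordering (G : groupType) := LeftOrdering {
  left_le :> rel G;
  left_le_refl : reflexive left_le;
  left_le_anti : antisymmetric left_le;
  left_le_trans : transitive left_le;
  left_le_total : total left_le;
  left_le_mul : forall f g h : G, left_le f g -> left_le (h * f) (h * g) }.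

HB.instance Definition _ (G : groupType) := gen_eqMixin (left_ordering G).
HB.instance Definition _ (G : groupType) := gen_choiceMixin (left_ordering G).

Definition left_orderable (G : groupType) : Prop := inhabited (left_ordering G).

Section LeftOrderingTopology.
Variable G : groupType.

Definition basic_open (F : {fset G}) : set (left_ordering G) :=
  [set le : left_ordering G | forall f, f \in F -> le 1 f].

Lemma basic_open_cover :
  \bigcup_(F in [set: {fset G}]) basic_open F = [set: left_ordering G].
Proof. by apply/seteqP; split=> // le _; exists fset0 => // f; rewrite inE. Qed.

Lemma basic_open_join (E F : {fset G}) (le : left_ordering G) :
  [set: {fset G}] E -> [set: {fset G}] F -> basic_open E le -> basic_open F le ->
  exists K, [/\ [set: {fset G}] K, basic_open K le &
                basic_open K `<=` basic_open E `&` basic_open F].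
Proof.
move=> _ _ Ele Fle; exists (E `|` F)%fset; split=> //.
  by move=> f; rewrite inE => /orP[/Ele|/Fle].
by move=> r Kr; split=> f fin; apply: Kr; rewrite inE fin ?orbT.
Qed.

HB.instance Definition _ := isBaseTopological.Build (left_ordering G)
  basic_open_cover basic_open_join.

End LeftOrderingTopology.

Definition homeomorphic (X Y : topologicalType) : Prop :=
  exists (f : X -> Y) (g : Y -> X),
    [/\ cancel f g, cancel g f, continuous f & continuous g].

(* Main.v *)
Require Import Defs.
From HB Require Import structures.
From mathcomp Require Import all_boot all_algebra finmap.
From mathcomp Require Import all_classical.
From mathcomp Require Import topology cantor.
From mathcomp Require Import reals Rstruct.
From Stdlib Require Setoid.
From mathcomp Require Import zify.

(** Recording the signs of the elements embeds the space of left-orderings of a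
    countable group in a Cantor space.  The space is compact, totally disconnected
    and metrizable, so it is a Cantor set as soon as it has no isolated point
    ([homeomorphic_cantor]).  It remains to show that a virtually solvable group
    with an isolated left-ordering has finite rank.

    Let [P] be the positive cone of an ordering that is isolated by the positivity
    of a finite set [F].  Everything is expressed with total preorders, which are
    orders on the cosets of a subgroup: any total preorder in which [F] is
    nonnegative is coarser than the order.  The structure is found by induction on
    the size of [F] ([isolated_structure]), by comparing [G] with its largest proper
    convex subgroup [S].

    Let [O] be the preorder defined by the order of [G / S].  If all elements of [F]
    move the coset of [c] to the right, then so do all elements of [P], and as [O] is
    maximal, the order of [G / S] looks the same from [c] as from the base point
    ([maximal_stabilizes]).  Let [N] be the normal core of a term of the derived series
    of a solvable subgroup, such that [N] acts on [G / S] by commuting maps and moves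
    the base point.  If the orbit of the base point under [N] clusters at it from both
    sides, the order looks the same from the nearby points of the orbit, hence from all
    of them, and [S] acts trivially ([clusters_biinvariant]).  If not, either the base
    point has a successor or a predecessor in [G / S], or [N] acts as a group of powers
    of one central translation ([clusters_or_periodic]).  In the latter case the
    previous term of the series acts by commuting maps as well
    ([periodic_commutator]), so that one may assume that [N] is the first one, which
    contains a power of each element of [S].  In all cases [O] is bi-invariant
    ([maximal_cone_biinvariant]).  Then [G / S] is abelian by Holder's argument
    ([holder]), and of rank one, since otherwise the order could be perturbed without
    changing the signs of [F] ([rank_one]).

    The induction needs two facts about [S].  The first one is used to control the
    action of [S] near the base point: up to reversal, the preorders of [S] are
    coarser than conjugates of [P] by finitely many elements.  It passes from [S] to
    [G] because some element of [G] inverts the order of [S] ([inverting_element],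
    [finite_orbits_extend]); without such an element, the conjugation by an element
    that expands the top quotient of [S] would produce a convex subgroup larger than
    [S] ([no_inversion_absurd]).  The second fact is a bound on the ranks of the
    abelianizations of all subgroups, which increases by one from [S] to [G]
    ([chain_length_extend]).  For [G] itself it says that all the solvable subgroups
    have finite rank. *)

Set Implicit Arguments.
Unset Strict Implicit.
Unset Printing Implicit Defensive.

Local Open Scope group_scope.

(** * Total cones *)

Ltac gsimp := rewrite ?(invgM, invgK, invg1, mulgA, mulgK, mulgVK, mulgV, mulVg,
                        mul1g, mulg1).

Section PreCones.
Variable G : groupType.
Implicit Types (x y z g h a b c f : G) (R O P N : G -> Prop) (n m k : nat).

(** The nonnegative elements of a left-invariant total preorder, in which [x <= y]
    means [R (x^-1 * y)] and [1 < x] means [~ R x^-1].  It is a total order on the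
    cosets of the subgroup [null R], and left multiplication acts on these points. *)
Definition total_cone R :=
  (forall x y, R x -> R y -> R (x * y)) /\ (forall x, R x \/ R x^-1).

Definition order_cone P :=
  total_cone P /\ (forall x, P x -> P x^-1 -> x = 1).

Definition subgroup N :=
  [/\ N 1, forall x y, N x -> N y -> N (x * y) & forall x, N x -> N x^-1].

Definition normal N := subgroup N /\ forall g x, N x -> N (g^-1 * x * g).

Definition null R x := R x /\ R x^-1.

(** The conjugate [c O c^-1] consists of the elements that move the point [c] weakly
    to the right: the order looks the same from [c] as from the base point. *)
Definition stabilizes O c := forall x, O x <-> O (c^-1 * x * c).

Lemma conj_expg c x n : c^-1 * x ^+ n * c = (c^-1 * x * c) ^+ n.
Proof.
elim: n => [|n IH]; first by rewrite !expg0; gsimp.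
by rewrite !expgS -IH; gsimp.
Qed.

Lemma expgC x n : x * x ^+ n = x ^+ n * x.
Proof. by rewrite -expgS expgSr. Qed.

Section Cone.
Variable R : G -> Prop.
Hypothesis tR : total_cone R.

Lemma coneM x y : R x -> R y -> R (x * y). Proof. by case: tR => + _; apply. Qed.

Lemma cone1 : R 1. Proof. by case: tR => _ /(_ 1); rewrite invg1 => -[]. Qed.

Lemma coneN x : ~ R x -> R x^-1. Proof. by case: tR => _ /(_ x) [|//]. Qed.

Lemma coneNV x : ~ R x^-1 -> R x. Proof. by case: tR => _ /(_ x) [|//]. Qed.

Lemma coneX x n : R x -> R (x ^+ n).
Proof.
move=> Rx; elim: n => [|n IH]; first exact: cone1.
by rewrite expgS; apply: coneM.
Qed.

Lemma cone_root x n : (0 < n)%N -> R (x ^+ n) -> R x.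
Proof.
case: n => // n _ Rn; case: tR => _ /(_ x) [//|Rx].
by rewrite -[x](mulgK (x ^+ n)) -expgS -expVgn; apply: coneM => //; apply: coneX.
Qed.

Lemma cone_sposM x y : R x -> ~ R y^-1 -> ~ R (x * y)^-1.
Proof.
move=> Rx Ry Rxy; apply: Ry; rewrite invgM in Rxy.
by rewrite -[y^-1](mulgVK x); apply: coneM.
Qed.

Lemma cone_sposMl x y : ~ R x^-1 -> R y -> ~ R (x * y)^-1.
Proof.
move=> Rx Ry Rxy; apply: Rx; rewrite invgM in Rxy.
by rewrite -[x^-1](mulKg y^-1) invgK; apply: coneM => //.
Qed.

Lemma cone_sposX x n : (0 < n)%N -> ~ R x^-1 -> ~ R (x ^+ n)^-1.
Proof. by move=> n0 Rx; rewrite -expVgn => /cone_root; auto. Qed.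

Lemma null_subgroup : subgroup (null R).
Proof.
split; first by rewrite /null invg1; split; exact: cone1.
  by move=> x y [? ?] [? ?]; split; rewrite ?invgM; apply: coneM.
by move=> x [? ?]; split; rewrite ?invgK.
Qed.

Lemma conj_cone c : total_cone (fun x => R (c^-1 * x * c)).
Proof.
split=> [x y Rx Ry|x].
  by have := coneM Rx Ry; gsimp.
by case: tR => _ /(_ (c^-1 * x * c)); gsimp.
Qed.

Lemma inv_cone : total_cone (fun x => R x^-1).
Proof.
split=> [x y Rx Ry|x]; first by rewrite invgM; apply: coneM.
by case: tR => _ /(_ x) []; rewrite invgK; auto.
Qed.

End Cone.

Section Subgroup.
Variable N : G -> Prop.
Hypothesis sN : subgroup N.
Lemma sub1 : N 1. Proof. by case: sN. Qed.
Lemma subM x y : N x -> N y -> N (x * y). Proof. by case: sN => _ + _; apply. Qed.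
Lemma subV x : N x -> N x^-1. Proof. by case: sN => _ _; apply. Qed.
Lemma subVE x : N x^-1 -> N x. Proof. by rewrite -{2}[x]invgK; apply: subV. Qed.
Lemma subX x n : N x -> N (x ^+ n).
Proof.
by move=> Nx; elim: n => [|n IH]; [exact: sub1|rewrite expgS; apply: subM].
Qed.
End Subgroup.

Lemma normalJ N g x : normal N -> N x -> N (g^-1 * x * g).
Proof. by case=> _; apply. Qed.

Lemma normalJV N g x : normal N -> N x -> N (g * x * g^-1).
Proof. by move=> nN Nx; rewrite -{1}[g]invgK; apply: normalJ. Qed.

Lemma stabilizes_subgroup O : subgroup (stabilizes O).
Proof.
split=> [x|c d Oc Od x|c Oc x]; first by gsimp.
  by rewrite Oc Od; gsimp.
by split=> Ox; [rewrite Oc|rewrite Oc in Ox]; move: Ox; gsimp.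
Qed.

Lemma null_stabilizes O s : total_cone O -> null O s -> stabilizes O s.
Proof.
move=> tO [Os OVs] x; split=> Ox.
  by apply: (coneM tO) => //; apply: (coneM tO).
have := coneM tO (coneM tO Os Ox) OVs; by gsimp.
Qed.

(** A proper total cone [O] containing [P] and maximal among them; its null
    subgroup is the largest proper convex subgroup of the order of [P]. *)
Record maximal_cone P O : Prop := MaximalCone {
  max_total : total_cone O;
  max_sub : forall x, P x -> O x;
  max_proper : exists x, ~ O x;
  max_max : forall R, total_cone R -> (forall x, P x -> R x) ->
    (forall x, R x -> O x) \/ (forall x, R x) }.

(** Isolation is required among total preorders.  This is not stronger than isolation
    among orders, since [P] refines every preorder to an order, and it makes
    the notion hereditary for convex subgroups. *)
Definition isolated_by P (F : seq G) :=
  [/\ order_cone P, forall f, f \in F -> P f &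
      forall R, total_cone R -> (forall f, f \in F -> R f) -> forall x, P x -> R x].

Lemma inv_order_cone P : order_cone P -> order_cone (fun x => P x^-1).
Proof.
move=> [tP aP]; split; first exact: inv_cone.
by move=> x Px; rewrite invgK => Py; apply: aP.
Qed.

Lemma maximal_cone_inv P O : maximal_cone P O ->
  maximal_cone (fun x => P x^-1) (fun x => O x^-1).
Proof.
case=> tO PO [y Oy] mO; split; first exact: inv_cone.
- by move=> x /PO.
- by exists y^-1; rewrite invgK.
- move=> R tR PR; case: (mO (fun x => R x^-1)) => [|x Px|RO|RT].
  + exact: inv_cone.
  + by apply: PR; rewrite invgK.
  + by left=> x Rx; apply: RO; rewrite invgK.
  + by right=> x; rewrite -[x]invgK.
Qed.

Lemma isolated_by_inv P F : isolated_by P F ->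
  isolated_by (fun x => P x^-1) [seq f^-1 | f <- F].
Proof.
case=> oP FP iP; split; first exact: inv_order_cone.
  by move=> _ /mapP [f fF ->]; rewrite invgK; apply: FP.
move=> R tR FR x Px; rewrite -[x]invgK.
apply: (iP (fun x => R x^-1)) => //; first exact: inv_cone.
by move=> f fF; apply: FR; apply: map_f.
Qed.

Section Maximal.
Variables P O : G -> Prop.
Hypothesis mO : maximal_cone P O.
Let tO := max_total mO.

(** By maximality [c O c^-1] lies in [O], so [c^-1 O c] contains [O], hence [P], and it
    lies in [O] too. *)
Lemma maximal_stabilizes c :
  (forall x, P x -> O (c^-1 * x * c)) -> stabilizes O c.
Proof.
move=> Pc; have [z Oz] := max_proper mO.
have sub R : total_cone R -> (forall x, P x -> R x) -> ~ (forall x, R x) ->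
  forall x, R x -> O x by move=> tR PR nR; case: (max_max mO tR PR).
have Oc : forall x, O (c^-1 * x * c) -> O x.
  apply: sub => //; first exact: conj_cone.
  by move=> /(_ (c * z * c^-1)); gsimp.
move=> x; split=> [Ox|]; last exact: Oc.
apply: (sub (fun x => O (c * x * c^-1))).
- by have := conj_cone tO c^-1; rewrite invgK.
- move=> y Py; apply: Oc; gsimp; exact: (max_sub mO).
- by move=> /(_ (c^-1 * z * c)); gsimp.
- by gsimp.
Qed.

(** Let [D] be the set of the points below some power of [a].  The [g] such that [g D]
    contains [D] form a total cone; it contains [P] and [a^-1], so it is everything. *)
Lemma stabilizes_cofinal a : stabilizes O a -> ~ O a^-1 ->
  forall g, exists m, O (g^-1 * a ^+ m).
Proof.
move=> Oa aV; pose R g := forall n, exists m, O (a ^- n * g * a ^+ m).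
have tR : total_cone R.
  split=> [g h Rg Rh n|g].
    have [m gm] := Rg n; have [k hk] := Rh m; exists k.
    by have := coneM tO gm hk; gsimp.
  case: (pselect (R g)) => [|/existsNP [n] /forallNP Rg]; first by left.
  right=> m; exists n; have := coneN tO (Rg m); by gsimp.
have PR x : P x -> R x.
  move=> /(max_sub mO) Ox n; exists n.
  exact/(subX (stabilizes_subgroup O) n Oa x).
case: (max_max mO tR PR) => [RO|RT].
  exfalso; apply: aV; apply: RO => n; exists n.+1.
  rewrite expgSr -mulgA mulgA -[in X in O (X * _)]expVgn -expgSr expgS.
  by rewrite -mulgA expVgn; gsimp; exact: (cone1 tO).
by move=> g; have [m] := RT g^-1 0; rewrite expg0 invg1 mul1g => ?; exists m.
Qed.

(** The index of the translate of a fundamental domain of [a] that contains [g]. *)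
Lemma stabilizes_floor a : stabilizes O a -> ~ O a^-1 ->
  forall g, O g -> exists n, O (a ^- n * g) /\ ~ O (a ^- n.+1 * g).
Proof.
move=> Oa aV g Og; have [m0 gm0] := stabilizes_cofinal Oa aV g.
have ex : exists m, `[< ~ O (a ^- m * g) >].
  exists m0.+1; apply/asboolP => Om.
  by apply: aV; have := coneM tO Om gm0; rewrite expgSr; gsimp.
case: (ex_minnP ex) => [[|n]] /asboolP nm minm.
  by exfalso; apply: nm; rewrite expg0; gsimp.
exists n; split=> //; apply: contrapT => On.
by have := minm n (asboolT On); rewrite ltnn.
Qed.

End Maximal.
End PreCones.

(** * Bi-invariant cones and the theorem of Holder *)

Section BiInvariance.
Variable G : groupType.
Implicit Types (x y z g h a b c f : G) (n m k : nat).
Variables P O : G -> Prop.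
Hypothesis mO : maximal_cone P O.
Let tO := max_total mO.

(** The successor [f] of the base point has its own successor at [f * f], and so on:
    the powers of [f] exhaust the points. *)
Lemma least_positive_biinvariant f : ~ O f^-1 ->
  (forall g, ~ O g^-1 -> O (f^-1 * g)) -> forall g, stabilizes O g.
Proof.
move=> fpos least.
have Of : stabilizes O f.
  apply: (maximal_stabilizes mO) => x /(max_sub mO) Ox.
  rewrite -mulgA; apply: least => fx; apply: fpos.
  by have := coneM tO fx Ox; gsimp.
have sO := stabilizes_subgroup O.
suff pos g : O g -> stabilizes O g.
  move=> g; case: tO => _ /(_ g) [Og|Og]; first exact: pos.
  exact: (subVE sO (pos _ Og)).
move=> /(stabilizes_floor mO Of fpos) [n [Og Ogn]].
rewrite -[g](mulVKg (f ^+ n)); apply: (subM sO); first exact: (subX sO).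
apply: null_stabilizes => //; split=> //.
apply: contrapT => /least; apply: contra_not Ogn.
by rewrite expgSr; gsimp.
Qed.

Lemma least_positive_in (l : seq G) : (exists2 f, f \in l & ~ O f^-1) ->
  exists f, [/\ f \in l, ~ O f^-1 &
    forall g, g \in l -> ~ O g^-1 -> O (f^-1 * g)].
Proof.
elim: l => [[f]//|a l IH] [f fl fO].
case: (pselect (exists2 f, f \in l & ~ O f^-1)) => [/IH [b [bl bO bmin]]|nol].
  case: (pselect (~ O a^-1 /\ ~ O (b^-1 * a))) => [[aO ba]|nab].
    exists a; split=> //; first by rewrite inE eqxx.
    move=> g; rewrite inE => /predU1P [->|gl] gO; first by gsimp; exact: (cone1 tO).
    have := coneM tO (coneN tO ba) (bmin g gl gO); by gsimp.
  exists b; split=> //; first by rewrite inE bl orbT.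
  move=> g; rewrite inE => /predU1P [->|gl] gO; last exact: bmin.
  by apply: contrapT => ba; apply: nab.
have fa : f = a.
  by move: fl; rewrite inE => /predU1P [//|fl]; case: nol; exists f.
have aO : ~ O a^-1 by rewrite -fa.
exists a; split=> //; first by rewrite inE eqxx.
move=> g; rewrite inE => /predU1P [->|gl] gO; first by gsimp; exact: (cone1 tO).
by case: nol; exists g.
Qed.

(** Otherwise the reverse of [O] would be nonnegative on [F] too, hence on [P], and [O]
    would be improper. *)
Lemma isolated_meets_positive F : isolated_by P F -> exists2 f, f \in F & ~ O f^-1.
Proof.
case=> oP FP iP; apply: contrapT => nof.
have PO' x : P x -> O x^-1.
  apply: (iP (fun x => O x^-1)); first exact: inv_cone.
  by move=> f fF; apply: contrapT => fO; apply: nof; exists f.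
have [x Ox] := max_proper mO; apply: Ox.
case: oP => -[_ /(_ x) Px] _; case: Px => [|/PO']; first exact: (max_sub mO).
by rewrite invgK.
Qed.

(** Elements of [null O] fix all points when [null O] is normal.  Let [f] be the least
    strictly positive element of [F]: the points [y] between [1] and [f] are moved to
    the right by [F], because [b * y >= b >= f >= y] for each strictly positive [b] in
    [F].  If there are such points strictly inside, their powers come close to every
    other point; if there are none, [f] is a successor of the base point. *)
Lemma normal_null_biinvariant F : isolated_by P F ->
  (forall g s, null O s -> null O (g^-1 * s * g)) ->
  forall g, stabilizes O g.
Proof.
move=> iF nS.
have [f [fF fpos fmin]] := least_positive_in (isolated_meets_positive iF).
case: iF => oP FP iP.
have small y : O y -> ~ O (f^-1 * y) -> stabilizes O y.
  move=> Oy yf; apply: (maximal_stabilizes mO).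
  apply: iP; first exact: conj_cone.
  move=> b bF; case: (pselect (O b^-1)) => Ob.
    by case: (nS y b) => //; split=> //; apply/(max_sub mO)/FP.
  have := coneN tO yf; rewrite invgM invgK => yf'.
  have := coneM tO (coneM tO yf' (fmin b bF Ob)) Oy; by gsimp.
case: (pselect (exists x, ~ O x^-1 /\ ~ O (f^-1 * x))) => [[x [xpos xf]]|nox].
  have Ox := small x (coneNV tO xpos) xf.
  have sO := stabilizes_subgroup O.
  suff pos g : O g -> stabilizes O g.
    move=> g; case: tO => _ /(_ g) [Og|Og]; first exact: pos.
    exact: (subVE sO (pos _ Og)).
  move=> /(stabilizes_floor mO Ox xpos) [n [Og Ogn]].
  rewrite -[g](mulVKg (x ^+ n)); apply: (subM sO); first exact: (subX sO).
  apply: small => // fg; apply: Ogn.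
  have := coneN tO xf; rewrite invgM invgK => xf'.
  have := coneM tO xf' fg; rewrite expgSr; by gsimp.
apply: (least_positive_biinvariant fpos) => g gpos.
by apply: contrapT => fg; apply: nox; exists g.
Qed.

Section Holder.
Hypothesis biO : forall g, stabilizes O g.

Let OJ g x : O x -> O (g^-1 * x * g). Proof. by move=> /(biO g). Qed.

Lemma null_normal : normal (null O).
Proof.
split; first exact: null_subgroup.
move=> g x [Ox OVx]; split; first exact: OJ.
by have := OJ g OVx; gsimp.
Qed.

(** Suppose that [c = x y x^-1 y^-1] is positive.  Either [c] is a successor of the
    base point, and all elements are powers of [c] modulo [null O] and commute, or there
    is a positive [w] with [w^2 <= c].  In the second case let [w^n] and [w^m] be the
    floors of [x] and [y]: then [x y < w^(n + m + 2)], while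
    [x y = c y x >= w^2 w^(n + m)]. *)
Lemma holder_pos x y : O x -> O y -> O (x * y * x^-1 * y^-1)^-1.
Proof.
move=> Ox Oy; apply: contrapT; move cE: (x * y * x^-1 * y^-1) => c cpos.
have xyE : x * y = c * (y * x) by rewrite -cE; gsimp.
case: (pselect (exists z, ~ O z^-1 /\ ~ O (c^-1 * z))) => [[z [zpos zc]]|noz].
  have [w wpos wc] : exists2 w, ~ O w^-1 & O (w^-1 * w^-1 * c).
    case: (pselect (O (z^-1 * z^-1 * c))) => Oz; first by exists z.
    exists (z^-1 * c); first by rewrite invgM invgK.
    have := OJ (z^-1 * c) (coneN tO Oz); by gsimp.
  have [n [xn xn1]] := stabilizes_floor mO (biO w) wpos Ox.
  have [m [ym ym1]] := stabilizes_floor mO (biO w) wpos Oy.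
  apply: ym1; move uE: (w ^- n.+1 * x) xn1 => u xn1.
  have uV : O u^-1 by exact: coneN xn1.
  suff E : O (w ^- m.+1 * u * y).
    by have := coneM tO (OJ (w ^+ m.+1) uV) E; rewrite ?mulgA; gsimp.
  have -> : w ^- m.+1 * u * y = w ^- n * w ^- m * w^-1 * w^-1 * c * y * x.
    have pw : w ^- m.+1 * w ^- n.+1 = w ^- n * w ^- m * w^-1 * w^-1.
      rewrite -!invgM -!expgnDr -!expgS; congr (_ ^- _); lia.
    by rewrite -uE mulgA pw -!mulgA xyE !mulgA.
  have H1 := OJ (w ^+ m) wc.
  have H2 := OJ (w ^+ n) (coneM tO H1 ym).
  by have := coneM tO H2 xn; gsimp.
have least g : ~ O g^-1 -> O (c^-1 * g).
  by move=> gpos; apply: contrapT => cg; apply: noz; exists g.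
have rest g : O g -> exists n, null O (c ^- n * g).
  move=> /(stabilizes_floor mO (biO c) cpos) [n [Og Ogn]]; exists n; split=> //.
  apply: contrapT => /least; apply: contra_not Ogn; rewrite expgSr; by gsimp.
have [n xn] := rest x Ox; have [m ym] := rest y Oy.
have nN := null_normal; have sN := nN.1.
have S1 := subM sN (normalJ (c ^+ m) nN xn) ym.
have S2 := subM sN (normalJ (c ^+ n) nN ym) xn.
have := normalJV (c ^+ (n + m)) nN (subM sN S1 (subV sN S2)).
apply: contra_not cpos => -[_]; congr O; congr (_^-1).
rewrite -[in RHS]cE {1}expgnDr addnC expgnDr; by gsimp.
Qed.

Lemma holder x y : null O (x * y * x^-1 * y^-1).
Proof.
have pos a b : O a -> O b -> null O (a * b * a^-1 * b^-1).
  move=> Oa Ob; split; last exact: holder_pos.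
  by have := holder_pos Ob Oa; gsimp.
have nN := null_normal; have sN := nN.1.
have posl a b : O a -> null O (a * b * a^-1 * b^-1).
  move=> Oa; case: (tO) => _ /(_ b) [|Ob]; first exact: pos.
  by have := normalJ b^-1 nN (subV sN (pos _ _ Oa Ob)); gsimp.
case: (tO) => _ /(_ x) [|Ox]; first exact: posl.
by have := normalJ x^-1 nN (subV sN (posl _ y Ox)); gsimp.
Qed.

End Holder.
End BiInvariance.

(** * Isolation implies rank one *)

(** Setoid rewriting with congruence modulo a normal subgroup replaces a computation
    in the quotient, which would need a new group type for each subgroup. *)
Definition eqmod (G : groupType) (S : G -> Prop) x y := S (x^-1 * y).

Section Congruence.
Variables (G : groupType) (S : G -> Prop).
Hypothesis nS : normal S.
Let sS := nS.1.
Implicit Types (x y z g h a b c f : G) (n m k : nat).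

Lemma eqmod_equiv : RelationClasses.Equivalence (eqmod S).
Proof.
split=> [x|x y Sxy|x y z Sxy Syz]; rewrite /eqmod.
- by gsimp; exact: sub1.
- by have := subV sS Sxy; gsimp.
- by have := subM sS Sxy Syz; gsimp.
Qed.

Lemma eqmodM x x' y y' :
  eqmod S x x' -> eqmod S y y' -> eqmod S (x * y) (x' * y').
Proof.
by move=> Sx Sy; have := subM sS (normalJ y nS Sx) Sy; rewrite /eqmod; gsimp.
Qed.

Lemma eqmodV x x' : eqmod S x x' -> eqmod S x^-1 x'^-1.
Proof.
by move=> Sx; have := normalJV x nS (subV sS Sx); rewrite /eqmod; gsimp.
Qed.

Lemma eqmodX x x' n : eqmod S x x' -> eqmod S (x ^+ n) (x' ^+ n).
Proof.
move=> Sx; elim: n => [|n IH]; first by case: eqmod_equiv.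
by rewrite !expgS; apply: eqmodM.
Qed.

Lemma eqmod_properM : Morphisms.Proper (Morphisms.respectful (eqmod S)
  (Morphisms.respectful (eqmod S) (eqmod S))) (@monoid.mul G).
Proof. by move=> x x' Sx y y' Sy; exact: eqmodM. Qed.

Lemma eqmod_properV :
  Morphisms.Proper (Morphisms.respectful (eqmod S) (eqmod S)) (@monoid.inv G).
Proof. by move=> x x' Sx; exact: eqmodV. Qed.

Lemma eqmod_properX : Morphisms.Proper (Morphisms.respectful (eqmod S)
  (Morphisms.respectful eq (eqmod S))) (@monoid.natexp G).
Proof. by move=> x x' Sx n _ <-; exact: eqmodX. Qed.

Lemma eqmod_sub x : eqmod S x 1 <-> S x.
Proof.
rewrite /eqmod mulg1; split; last exact: subV.
exact: subVE.
Qed.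

Lemma eqmodMl x s : S s -> eqmod S (s * x) x.
Proof.
by move=> Ss; have := normalJ x nS (subV sS Ss); rewrite /eqmod; gsimp.
Qed.

End Congruence.

Section RankOne.
Variable G : groupType.
Implicit Types (x y z g h a b c f w : G) (n m k : nat).
Variables P O : G -> Prop.
Hypothesis tO : total_cone O.
Hypothesis commO : forall x y, null O (x * y * x^-1 * y^-1).
Local Notation S := (null O).

Lemma comm_null_normal : normal S.
Proof.
have sS := null_subgroup tO; split=> // g x Sx.
have := subM sS Sx (commO x^-1 g^-1); by gsimp.
Qed.
Let nS := comm_null_normal.
Let sS := nS.1.

Local Instance eqmodO_equiv : RelationClasses.Equivalence _ := eqmod_equiv nS.
Local Instance eqmodO_mul : Morphisms.Proper _ _ := eqmod_properM nS.
Local Instance eqmodO_inv : Morphisms.Proper _ _ := eqmod_properV nS.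
Local Instance eqmodO_exp : Morphisms.Proper _ _ := eqmod_properX nS.
Local Infix "==~" := (eqmod S) (at level 70).
Local Hint Extern 0 (eqmod _ _ _) => reflexivity : core.

Lemma eqmodC x y : x * y ==~ y * x.
Proof. have := commO y^-1 x^-1; rewrite /eqmod; by gsimp. Qed.

Lemma eqmodCA x y z : x * (y * z) ==~ y * (x * z).
Proof. by rewrite !mulgA (eqmodC x y). Qed.

Lemma eqmodXM x y n : (x * y) ^+ n ==~ x ^+ n * y ^+ n.
Proof.
elim: n => [|n IH]; first by rewrite !expg0 mulg1.
by rewrite !expgS IH -!mulgA (eqmodCA y (x ^+ n)).
Qed.

(** A submonoid of [G / null O], as a saturated subset of [G]. *)
Definition submonoid (M : G -> Prop) :=
  [/\ M 1, forall x y, M x -> M y -> M (x * y) & forall x y, x ==~ y -> M x -> M y].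

Definition adjoin f (M : G -> Prop) x := exists k, M (f ^- k * x).

(** [M] meets every ray of positive elements: it spans the positive part of [G] over
    the rationals. *)
Definition covers (M : G -> Prop) :=
  forall w, ~ O w^-1 -> exists2 m, (0 < m)%N & M (w ^+ m).

Lemma submonoidX M x n : submonoid M -> M x -> M (x ^+ n).
Proof.
case=> M1 MM _ Mx; elim: n => [|n IH]; first by rewrite expg0.
by rewrite expgS; apply: MM.
Qed.

Lemma adjoin_sub f M x : M x -> adjoin f M x.
Proof. by exists 0; rewrite expg0 invg1 mul1g. Qed.

Lemma adjoin_gen f M : submonoid M -> adjoin f M f.
Proof. by case=> M1 _ _; exists 1%N; rewrite expg1 mulVg. Qed.

Lemma submonoid_adjoin f M : submonoid M -> submonoid (adjoin f M).
Proof.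
case=> M1 MM Ms; split; first exact: adjoin_sub.
- move=> x y [k Mx] [l My]; exists (l + k)%N; apply: Ms (MM _ _ Mx My).
  by rewrite expgnDr invgM -!mulgA (eqmodCA x).
- by move=> x y xy [k Mx]; exists k; apply: Ms Mx; rewrite xy.
Qed.

Lemma submonoid_null : submonoid S.
Proof.
split; first exact: (sub1 sS).
- by move=> x y; exact: (subM sS).
- by move=> x y xy Sx; rewrite -[y](mulVKg x); apply: (subM sS).
Qed.

(** Of two positive generators the larger one is redundant: a power [(f / g)^m] is a
    product of powers of [f] and [g] by an element of [M], and either this expresses a
    power of [f] by [g] and [M], or it makes a product of positive elements trivial. *)
Lemma covers_adjoin2 f g M : submonoid M -> (forall x, M x -> O x) ->
  ~ O f^-1 -> ~ O g^-1 -> O (f * g^-1) ->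
  covers (adjoin f (adjoin g M)) -> covers (adjoin g M).
Proof.
move=> sM MO fpos gpos fg cov; case: (sM) => M1 MM Ms.
have sA := submonoid_adjoin g sM; case: (sA) => A1 AM As.
(* [f >= g], so that a power of [f / g] is expressed by [f], [g] and [M] *)
have [N N0 fN] : exists2 N, (0 < N)%N & adjoin g M (f ^+ N).
  case: (pselect (O (f * g^-1)^-1)) => [fgV|fgpos].
    exists 1%N => //; rewrite expg1; apply: As (adjoin_gen g sM).
    by have := normalJ g nS (conj fg fgV); gsimp.
  have [m m0 [k [l Me]]] := cov _ fgpos.
  move eE : (g ^- l * (f ^- k * (f * g^-1) ^+ m)) Me => e Me.
  have eE' : f ^+ m ==~ f ^+ k * (g ^+ (l + m) * e).
    rewrite -eE expgnDr eqmodXM expVgn.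
    rewrite (eqmodC (g ^+ l)) -!mulgA mulVKg.
    by rewrite (eqmodCA (g ^+ m)) mulVKg (eqmodC (g ^+ m)) mulgVK.
  case: (ltnP k m) => km.
    exists (m - k)%N; first by rewrite subn_gt0.
    exists (l + m)%N; apply: Ms Me.
    rewrite -[m in f ^+ (m - k)](subnK (ltnW km)) addnK.
    move: eE'; rewrite -{1}[m](subnKC (ltnW km)) expgnDr => eE'.
    have <- : f ^- k * (f ^+ k * (g ^+ (l + m) * e)) ==~ f ^+ (m - k).
      by rewrite -eE' mulKg.
    by rewrite !mulKg.
  exfalso; apply: (cone_sposMl tO (x := g ^+ (l + m)) (y := e * f ^+ (k - m))).
  - by apply: (cone_sposX tO) => //; rewrite addn_gt0 m0 orbT.
  - by apply: (coneM tO); [exact: MO|apply: (coneX tO); apply: (coneNV tO)].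
  - suff : S (g ^+ (l + m) * (e * f ^+ (k - m))) by case.
    apply/(eqmod_sub nS); rewrite mulgA (eqmodC _ (f ^+ _)).
    move: eE'; have -> : f ^+ k = f ^+ m * f ^+ (k - m) by rewrite -expgnDr subnKC.
    rewrite -mulgA => eE'.
    have <- : f ^- m * (f ^+ m * (f ^+ (k - m) * (g ^+ (l + m) * e))) ==~ 1.
      by rewrite -eE' mulVg.
    by rewrite mulKg.
move=> w wpos; have [m m0 [k [l Me]]] := cov w wpos.
exists (m * N)%N; first by rewrite muln_gt0 m0.
have : adjoin g M (g ^+ (l * N) * (g ^- l * (f ^- k * w ^+ m)) ^+ N * (f ^+ N) ^+ k).
  apply: (AM); last exact: submonoidX.
  apply: (AM); last by apply: submonoidX => //; apply: adjoin_sub.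
  by apply: submonoidX => //; exact: adjoin_gen.
apply: As; rewrite !eqmodXM -!expgnA !expVgn -!expgnA mulVKg.
by rewrite (eqmodC (f ^- _)) -mulgA [(N * k)%N]mulnC mulVg mulg1.
Qed.

Lemma covers_ext M M' : (forall x, M x -> M' x) -> covers M -> covers M'.
Proof. by move=> MM' cM w /cM [m m0 Mw]; exists m => //; apply: MM'. Qed.

Lemma adjoinC f g M x : submonoid M ->
  adjoin f (adjoin g M) x -> adjoin g (adjoin f M) x.
Proof.
case=> _ _ Ms [k [l Mx]]; exists l, k; apply: Ms Mx; exact: eqmodCA.
Qed.

Definition generated (l : seq G) := foldr adjoin S l.

Lemma submonoid_generated l : submonoid (generated l).
Proof.
by elim: l => [|f l IH]; [exact: submonoid_null|exact: submonoid_adjoin].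
Qed.

Lemma generated_mem f l : f \in l -> generated l f.
Proof.
elim: l => // g l IH; rewrite inE => /predU1P [->|/IH].
  exact: adjoin_gen (submonoid_generated l).
exact: adjoin_sub.
Qed.

Lemma generated_cone l : (forall f, f \in l -> O f) -> forall x, generated l x -> O x.
Proof.
elim: l => [|f l IH] lO x; first by case.
case=> k /IH Ox; rewrite -[x](mulVKg (f ^+ k)); apply: (coneM tO).
  by apply: (coneX tO); apply: lO; rewrite inE eqxx.
by apply: Ox => g gl; apply: lO; rewrite inE gl orbT.
Qed.

(** Induction on the number of generators: of the first two, the larger one is dropped. *)
Lemma covers_one_generator l : (forall f, f \in l -> O f) ->
  covers (generated l) -> covers S \/ exists2 f, ~ O f^-1 & covers (adjoin f S).
Proof.
have [n] := ubnP (size l); elim: n l => // n IH [|f [|g l]] ln lO cov.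
- by left.
- case: (pselect (O f^-1)) => Of; last by right; exists f.
  left; apply: covers_ext cov => x [k Sx]; rewrite -[x](mulVKg (f ^+ k)).
  apply: (subM sS) => //; apply: (subX sS); split=> //.
  by apply: lO; rewrite inE eqxx.
have drop a b : (forall c, c \in a :: b :: l -> O c) ->
  covers (generated (a :: b :: l)) ->
  O a^-1 \/ [/\ ~ O a^-1, ~ O b^-1 & O (a * b^-1)] ->
  covers (generated (b :: l)).
  move=> abO cab [aV|[aV bV ab]]; last first.
    apply: (covers_adjoin2 _ _ aV bV ab cab); first exact: submonoid_generated.
    by apply: generated_cone => c cl; apply: abO; rewrite !inE cl !orbT.
  apply: covers_ext cab => x [k Mx].
  case: (submonoid_generated (b :: l)) => _ _ Ms.
  apply: Ms Mx; apply: (eqmodMl nS); apply: (subV sS); apply: (subX sS).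
  by split=> //; apply: abO; rewrite inE eqxx.
have lO' c : c \in g :: f :: l -> O c.
  by move=> cgf; apply: lO; move: cgf; rewrite !inE; do 2!case: eqP => //=.
have cov' : covers (generated (g :: f :: l)).
  by apply: covers_ext cov => x /(adjoinC (submonoid_generated l)).
suff [|] : covers (generated (g :: l)) \/ covers (generated (f :: l)).
- by apply: IH => // c cl1; apply: lO; rewrite inE cl1 orbT.
- by apply: IH => // c cl1; apply: lO'; rewrite inE cl1 orbT.
case: (pselect (O f^-1)) => fV; first by left; apply: drop cov _; [exact: lO|left].
case: (pselect (O g^-1)) => gV; first by right; apply: drop cov' _; [exact: lO'|left].
case: (tO) => _ /(_ (f * g^-1)) [fg|gf].
  by left; apply: drop cov _ => //; right.
right; apply: drop cov' _ => //; right; split=> //.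
by move: gf; gsimp.
Qed.

(** If no positive power of some [w > 1] is generated by [F], then a maximal submonoid
    that contains [F] and [w^-1] but not [w] is a total cone.  Its existence contradicts
    the isolation. *)
Lemma isolated_covers F : (forall x, P x -> O x) -> isolated_by P F ->
  covers (generated F).
Proof.
move=> PO [oP FP iP] w wpos; apply: contrapT => ncov.
have FO f : f \in F -> O f by move=> fF; apply/PO/FP.
have sF := submonoid_generated F; case: (sF) => F1 FM Fs.
pose base x := exists k, generated F (w ^+ k * x).
pose good (A : set G) := A = set0 \/ [/\ submonoid A, (base `<=` A)%classic & ~ A w].
have sbase : submonoid base.
  split.
  - by exists 0; rewrite expg0 mulg1.
  - move=> x y [k Mx] [l My]; exists (k + l)%N; apply: Fs (FM _ _ Mx My).
    by rewrite expgnDr -!mulgA (eqmodCA x).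
  - by move=> x y xy [k Mx]; exists k; apply: Fs Mx; rewrite xy.
have base_good : good base.
  right; split=> // -[k]; rewrite -expgSr => Mw.
  by apply: ncov; exists k.+1.
have [|A [gA maxA]] := @Zorn_bigcup G good.
  move=> C Cgood Ctot.
  case: (pselect (exists2 X, C X & X != set0)) => [[X CX X0]|noX]; last first.
    left; apply/seteqP; split=> // x [X CX Xx].
    by case: noX; exists X => //; apply/set0P; exists x.
  have goodC Y : C Y -> Y != set0 -> [/\ submonoid Y, (base `<=` Y)%classic & ~ Y w].
    by move=> /Cgood [->|//]; rewrite eqxx.
  right; split.
  - split.
    + by exists X => //; case: (goodC X CX X0) => -[].
    + move=> x y [Y CY Yx] [Z CZ Zy].
      have Y0 : Y != set0 by apply/set0P; exists x.
      have Z0 : Z != set0 by apply/set0P; exists y.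
      case: (Ctot Y Z CY CZ) => YZ.
        by exists Z => //; case: (goodC Z CZ Z0) => -[_ + _] _ _; apply=> //; apply: YZ.
      by exists Y => //; case: (goodC Y CY Y0) => -[_ + _] _ _; apply=> //; apply: YZ.
    + move=> x y xy [Y CY Yx]; exists Y => //.
      have Y0 : Y != set0 by apply/set0P; exists x.
      by case: (goodC Y CY Y0) => -[_ _ +] _ _; apply; [exact: xy|].
  - by move=> x bx; exists X => //; case: (goodC X CX X0) => _ + _; apply.
  - move=> [Y CY Yw]; have Y0 : Y != set0 by apply/set0P; exists w.
    by case: (goodC Y CY Y0).
have base1 : base 1 by exists 0; rewrite expg0 mulg1.
case: gA => [A0|[sA bA Aw]].
  exfalso; apply: (maxA base) base_good; rewrite A0; split=> // /(_ 1).
  exact.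
case: (sA) => A1 AM As.
have AwV : A w^-1 by apply: bA; exists 1%N; rewrite expg1 mulgV.
have root j : (0 < j)%N -> ~ A (w ^+ j).
  case: j => // j _ Aj; apply: Aw.
  rewrite -[w](mulgK (w ^+ j)) -expgS -expVgn; apply: AM => //.
  exact: submonoidX.
(* adjoining [x] outside of [A] to [A] brings in [w], by maximality *)
have adj x : ~ A x -> exists2 k, (0 < k)%N & exists2 a, A a & w ==~ x ^+ k * a.
  move=> Ax; apply: contrapT => nadj.
  apply: (maxA (adjoin x A)).
    split; first by move=> y; exact: adjoin_sub.
    by move=> /(_ x (adjoin_gen x sA)).
  right; split; first exact: submonoid_adjoin.
    by move=> y by_; apply: adjoin_sub; apply: bA.
  case=> -[|k] Ak; first by apply: Aw; move: Ak; rewrite expg0 invg1 mul1g.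
  by apply: nadj; exists k.+1 => //; exists (x ^- k.+1 * w) => //; rewrite mulVKg.
have tA : total_cone A.
  split=> // x; case: (pselect (A x)) => Ax; first by left.
  case: (pselect (A x^-1)) => AxV; [by right|exfalso].
  have [k k0 [a Aa wa]] := adj x Ax; have [l l0 [b Ab wb]] := adj x^-1 AxV.
  apply: (root (l + k)%N); first by rewrite addn_gt0 k0 orbT.
  apply: (As (a ^+ l * b ^+ k)); last by apply: AM; exact: submonoidX.
  rewrite expgnDr {1}wa wb !eqmodXM !expVgn -!expgnA [(l * k)%N]mulnC.
  by rewrite (eqmodC (x ^+ _)) -mulgA mulVKg.
have PA x : P x -> A x.
  by apply: iP => // f fF; apply: bA; exists 0; rewrite expg0 mul1g; exact: generated_mem.
case: oP => -[_ /(_ w) [/PA//|/PO//]].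
Qed.

(** By [covers_one_generator] a single [f] suffices to cover, so that [x] and [y] have
    powers which are powers of [f] modulo [null O]. *)
Lemma rank_one F : (forall x, P x -> O x) -> isolated_by P F ->
  forall x y, ~ O x^-1 -> ~ O y^-1 ->
  exists k l, [/\ (0 < k)%N, (0 < l)%N & S (x ^+ k * y ^- l)].
Proof.
move=> PO iF x y xpos ypos.
have FO f : f \in F -> O f.
  by case: iF => _ FP _ fF; apply/PO/FP.
case: (covers_one_generator FO (isolated_covers PO iF)) => [cS|[f fpos cf]].
  by exfalso; have [m m0 []] := cS x xpos; move=> _; exact: cone_sposX.
have pos z k m : ~ O z^-1 -> (0 < m)%N -> S (f ^- k * z ^+ m) -> (0 < k)%N.
  move=> zpos m0; case: k => // -[_].
  by rewrite expg0 invg1 mul1g => /(cone_sposX tO m0 zpos).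
have [m m0 [k Sk]] := cf x xpos; have [n n0 [l Sl]] := cf y ypos.
exists (m * l)%N, (n * k)%N; split.
- by rewrite muln_gt0 m0 (pos y l n).
- by rewrite muln_gt0 n0 (pos x k m).
apply/(eqmod_sub nS).
have xE : f ^+ k ==~ x ^+ m by [].
have yE : f ^+ l ==~ y ^+ n by [].
by rewrite !expgnA -xE -yE -!expgnA mulnC mulgV.
Qed.
End RankOne.

(** * The action of a normal subgroup with a gap *)

(** A bound on the ranks of the abelianizations of all subgroups of [S]: along a chain
    of [n] steps between a subgroup and its derived subgroup, some quotient is torsion.
    In terms of chains the bound can be compared for [S] and for a normal subgroup of
    it, without forming any abelianization. *)
Definition chain_length (G : groupType) (S : G -> Prop) n :=
  forall L : nat -> G -> Prop, (forall i, subgroup (L i)) ->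
    (forall i x, L i.+1 x -> L i x) -> (forall x, L 0 x -> S x) ->
    (forall x y, L 0 x -> L 0 y -> L n (x * y * x^-1 * y^-1)) ->
  exists2 i, (i < n)%N &
    forall x, L i x -> exists2 m, (0 < m)%N & L i.+1 (x ^+ m).

Section Series.
Variable G : groupType.
Implicit Types (x y z g h a b c f u v w : G) (n m k : nat).

(** The kernel of the action on the points of [O]. *)
Definition core (O : G -> Prop) x := forall g, null O (g^-1 * x * g).

(** The orbit of the base point under [N] clusters at the base point from the right. *)
Definition clusters (N O : G -> Prop) := forall f, ~ O f^-1 ->
  exists a, [/\ N a, ~ O a^-1 & ~ O (f^-1 * a)].

(** Modulo the kernel of the action, [N] is infinite cyclic, and its generator [z] is
    central in [G] and moves all points to the right. *)
Definition periodic (N O : G -> Prop) := exists z,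
  [/\ N z, ~ O z^-1, forall g, core O (g^-1 * z^-1 * g * z),
      forall a, N a -> O a -> exists n, core O (z ^- n * a) &
      forall a, N a -> null O a -> core O a].

Lemma core_normal O : total_cone O -> normal (core O).
Proof.
move=> tO; have sS := null_subgroup tO; split; first split.
- by move=> g; gsimp; exact: sub1.
- by move=> x y Cx Cy g; have := subM sS (Cx g) (Cy g); gsimp.
- by move=> x Cx g; have := subV sS (Cx g); gsimp.
- by move=> g x Cx h; have := Cx (g * h); gsimp.
Qed.

Lemma core_null O x : core O x -> null O x.
Proof. by move=> /(_ 1); gsimp. Qed.

Section NormalSubgroup.
Variables (P O N : G -> Prop).
Hypothesis mO : maximal_cone P O.
Let tO := max_total mO.
Let sS := null_subgroup tO.
Let nC := core_normal tO.
Hypothesis nN : normal N.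
Let sN := nN.1.
Hypothesis commN : forall x y, N x -> N y -> core O (x * y * x^-1 * y^-1).
Hypothesis N_pos : exists2 a, N a & ~ O a^-1.
Variable r : nat.
Hypothesis chainS : chain_length (null O) r.

(** Each element of [N] moves the point [g] in the same direction as the base point. *)
Definition same_sign g := forall a, N a -> (O a <-> O (g^-1 * a * g)).

Lemma same_sign_subgroup : subgroup same_sign.
Proof.
split=> [a Na|g h sg sh a Na|g sg a Na]; first by gsimp.
  rewrite (sg a Na) (sh (g^-1 * a * g)); last exact: normalJ.
  by gsimp.
have := sg _ (normalJV g nN Na); gsimp; tauto.
Qed.

Section Gap.
Variable f : G.
(** The orbit of the base point under [N] avoids the open interval from [1] to [f]. *)
Hypothesis fpos : ~ O f^-1.
Hypothesis gapf : forall a, N a -> ~ O a^-1 -> O (f^-1 * a).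

(** If [b] fixes a point [g] in the gap and moves the base point, then [b] or its inverse
    moves the base point to the right of [1] but not beyond [g]. *)
Lemma gap_fix g b : O g -> ~ O (f^-1 * g) -> N b ->
  null O (g^-1 * b * g) -> null O b.
Proof.
move=> Og fg.
have half c : N c -> null O (g^-1 * c * g) -> O c^-1.
  move=> Nc [_ cV]; apply: contrapT => /(gapf Nc) fc; apply: fg.
  by have := coneM tO fc (coneM tO Og cV); gsimp.
move=> Nb nb; split; last exact: half.
rewrite -[b]invgK; apply: half; first exact: subV.
by have := subV sS nb; gsimp.
Qed.

(** The conjugates of the stabilizer of the base point in [N] by the powers of [g]
    form a decreasing chain, by [gap_fix].  As the rank is finite some step of this
    chain is torsion, and it is an equality because stabilizers of points contain the
    roots of their elements. *)
Lemma gap_fixV g b : O g -> ~ O (f^-1 * g) -> N b ->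
  null O b -> null O (g^-1 * b * g).
Proof.
move=> Og fg Nb Sb.
pose L i x := N x /\ null O (g ^- i * x * g ^+ i).
have [i _ tors] : exists2 i, (i < r)%N &
    forall x, L i x -> exists2 m, (0 < m)%N & L i.+1 (x ^+ m).
  apply: chainS => [i|i x [Nx Lx]|x [_]|x y [Nx _] [Ny _]].
  - split; first by split; [exact: sub1|gsimp; exact: sub1].
      move=> x y [Nx Sx] [Ny Sy]; split; first exact: subM.
      by have := subM sS Sx Sy; gsimp.
    move=> x [Nx Sx]; split; first exact: subV.
    by have := subV sS Sx; gsimp.
  - split=> //; apply: (gap_fix Og fg); first exact: normalJ.
    by move: Lx; rewrite expgSr; gsimp.
  - by rewrite expg0; gsimp.
  - split; last exact: commN.
    by apply: (subM sN (subM sN (subM sN Nx Ny) (subV sN Nx)) (subV sN Ny)).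
have [|m m0 [_]] := tors (g ^+ i * b * g ^- i).
  by split; [exact: normalJV|gsimp].
rewrite conj_expg expgSr; gsimp => -[S1 S2].
split; first exact: cone_root S1.
by apply: (cone_root tO m0); rewrite expVgn.
Qed.

Lemma gap_same_sign g : O g -> ~ O (f^-1 * g) -> same_sign g.
Proof.
move=> Og fg.
have pos a : N a -> O a -> O (g^-1 * a * g).
  move=> Na Oa; case: (pselect (O a^-1)) => aV.
    by case: (gap_fixV Og fg Na (conj Oa aV)).
  have := coneN tO fg; rewrite invgM invgK => gf.
  by have := coneM tO (coneM tO gf (gapf Na aV)) Og; gsimp.
move=> a Na; split; first exact: pos.
move=> Oga; apply: contrapT => naO; have aV := coneN tO naO.
have OgaV := pos _ (subV sN Na) aV.
have [//] : null O a by apply: (gap_fix Og fg Na); split=> //; move: OgaV; gsimp.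
Qed.

(** [k] is a point of the interval from [1] to [x], on either side of [1]. *)
Definition between (k x : G) := (O k /\ O (k^-1 * x)) \/ (O k^-1 /\ O (x^-1 * k)).

Definition same_signs x := forall k : G, between k x -> same_sign k.

Lemma same_signs_between x y : between x y -> same_signs y -> same_signs x.
Proof.
have le a b c : O (a^-1 * b) -> O (b^-1 * c) -> O (a^-1 * c).
  by move=> ab bc; have := coneM tO ab bc; gsimp.
move=> [[Ox xy]|[xV yx]] sy k [[Ok kx]|[kV xk]]; apply: sy.
- by left; split=> //; exact: le xy.
- left; split; first by have := coneM tO Ox xk; gsimp.
  by have := coneM tO kV (coneM tO Ox xy); gsimp.
- right; split; last by have := coneM tO yx (coneM tO xV Ok); gsimp.
  by have := coneM tO kx xV; gsimp.
- by right; split=> //; exact: le xk.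
Qed.

Lemma same_signs_self x : same_signs x -> same_sign x.
Proof.
apply; case: (tO) => _ /(_ x) [Ox|Ox]; [left|right];
by split=> //; rewrite mulVg; exact: cone1.
Qed.

Lemma same_signs_subgroup : subgroup same_signs.
Proof.
have sE := same_sign_subgroup.
split.
- move=> k kb; have [Ok OkV] : null O k.
    by case: kb => -[]; rewrite ?mulg1 ?invg1 ?mul1g.
  move=> a _; split=> Oa; first exact: (coneM tO (coneM tO OkV Oa) Ok).
  by have := coneM tO (coneM tO Ok Oa) OkV; gsimp.
- move=> g h Tg Th k kb.
  suff [/Tg//|/Th sk] : between k g \/ between (g^-1 * k) h.
    by rewrite -[k](mulVKg g); apply: (subM sE) => //; exact: same_signs_self.
  case: kb => -[Ok kgh].
    case: (pselect (O (k^-1 * g))) => kg; first by left; left.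
    right; left; split; first by have := coneN tO kg; gsimp.
    by move: kgh; gsimp.
  case: (pselect (O (g^-1 * k))) => kg; first by left; right.
  right; right; split; first by have := coneN tO kg; gsimp.
  by move: kgh; gsimp.
- move=> g Tg k kb.
  have sgk : same_sign (g * k).
    apply: Tg; case: kb => -[Ok kg]; [right|left]; split=> //.
    - by move: kg; gsimp.
    - by gsimp.
    - by move: kg; gsimp.
    - by gsimp.
  rewrite -[k](mulKg g); apply: (subM sE) => //; apply: (subV sE); exact: same_signs_self.
Qed.

(** The largest convex block around the base point on which every element of
    [N] has the same sign is a convex subgroup; it is larger than the maximal
    one, so it is everything. *)
Lemma gap_same_sign_all g0 : ~ O g0^-1 -> ~ O (f^-1 * g0) ->
  forall g, same_sign g.
Proof.
move=> g0pos fg0; have Og0 := coneNV tO g0pos.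
have sT := same_signs_subgroup; have sE := same_sign_subgroup.
pose R x := O x \/ same_signs x.
have tR : total_cone R.
  split=> [x y|x]; last first.
    by case: (tO) => _ /(_ x) []; [left; left|right; left].
  move=> [Ox|Tx] [Oy|Ty].
  - by left; exact: coneM.
  - case: (pselect (O (x * y))) => Oxy; [by left|right].
    have xyV := coneN tO Oxy; apply: (subM sT) => //; apply: (subVE sT).
    apply: same_signs_between Ty; right; split; first by rewrite invgK.
    by move: xyV; gsimp.
  - case: (pselect (O (x * y))) => Oxy; [by left|right].
    have xyV := coneN tO Oxy; apply: same_signs_between Tx.
    by right; split=> //; gsimp.
  - by right; exact: (subM sT Tx Ty).
have Tg0 : same_signs g0.
  move=> k kb; have [Ok kg0] : O k /\ O (k^-1 * g0).
    case: kb => -[] // kV gk; split; first by have := coneM tO Og0 gk; gsimp.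
    exact: coneM.
  apply: gap_same_sign => // fk; apply: fg0.
  by have := coneM tO fk kg0; gsimp.
have [RO|RT] := max_max mO tR (fun x Px => or_introl (max_sub mO Px)).
  by exfalso; apply/g0pos/RO; right; exact: (subV sT Tg0).
move=> g; case: (RT g) => [Og|/same_signs_self//];
  case: (RT g^-1) => [OgV|/same_signs_self sg].
  move=> a _; split=> Oa; first exact: (coneM tO (coneM tO OgV Oa) Og).
  by have := coneM tO (coneM tO Og Oa) OgV; gsimp.
exact: (subVE sE sg).
Qed.

Section Periodic.
Variable g0 : G.
Hypothesis g0pos : ~ O g0^-1.
Hypothesis g0f : ~ O (f^-1 * g0).
Hypothesis signE : forall g, same_sign g.

Let pos a := N a /\ ~ O a^-1.

Let NJ g a : N a -> O a -> O (g^-1 * a * g).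
Proof. by move=> Na /(signE g Na). Qed.

Let posJ g a : pos a -> pos (g^-1 * a * g).
Proof.
move=> [Na aV]; split; first exact: normalJ.
by move=> gaV; apply/aV/(signE g (subV sN Na)); move: gaV; gsimp.
Qed.

Let posO a : pos a -> O a. Proof. by case=> _ /(coneNV tO). Qed.

(** If there is no least positive element in [N], then every positive [a] in [N] is at
    least the square of another one.  So the [g] with [a * g >= 1] for all positive [a]
    in [N] form a total cone.  It contains [P], and [g0^-1] because [g0] lies in the gap,
    but not the elements [a^-1 * a^-1]. *)
Lemma gap_least : exists2 z, pos z & forall a, pos a -> O (z^-1 * a).
Proof.
apply: contrapT => noleast.
have less a : pos a -> exists2 b, pos b & ~ O (a^-1 * b).
  move=> pa; apply: contrapT => nb; apply: noleast; exists a => // b pb.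
  by apply: contrapT => ab; apply: nb; exists b.
have half a : pos a -> exists2 b, pos b & O (b^-1 * b^-1 * a).
  move=> pa; have [b pb ab] := less a pa.
  have pb' : pos (b^-1 * a).
    split; first by apply: (subM sN); [apply: (subV sN)|]; [case: pb|case: pa].
    by rewrite invgM invgK.
  case: (pselect (O (b^-1 * b^-1 * a))) => bba; first by exists b.
  exists (b^-1 * a) => //.
  have Nx : N (b^-1 * b^-1 * a) by have := subM sN (subV sN pb.1) pb'.1; gsimp.
  by have := NJ (b^-1 * a) (subV sN Nx) (coneN tO bba); gsimp.
pose R g := forall a, pos a -> O (a * g).
have tR : total_cone R.
  split=> [g h Rg Rh a pa|g].
    have [b pb bba] := half a pa.
    have Nx : N (b^-1 * b^-1 * a).
      by apply: (subM sN (subM sN (subV sN pb.1) (subV sN pb.1)) pa.1).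
    have H1 := NJ (b * b)^-1 Nx bba.
    have H2 := coneM tO (Rg b pb) (Rh _ (posJ (b * g) pb)).
    by have := coneM tO H1 H2; gsimp.
  case: (pselect (R g)) => [|/existsNP [a /not_implyP [pa /(coneN tO) ag]]].
    by left.
  right=> b pb; have Oba := posO (posJ (g^-1 * a^-1) pb).
  have := coneM tO (coneM tO ag Oba) (posO pa); by gsimp.
have PR x : P x -> R x.
  by move=> /(max_sub mO) Ox a pa; apply: (coneM tO) => //; exact: posO.
have [RO|RT] := max_max mO tR PR.
  apply: g0pos; apply: RO => a pa.
  have [Na aV] := posJ g0^-1 pa.
  have := coneN tO g0f; rewrite invgM invgK => g0f'.
  by have := coneM tO g0f' (gapf Na aV); gsimp.
have [a Na aV] := N_pos.
by have := RT (a^-1 * a^-1) a (conj Na aV); gsimp.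
Qed.

(** The least positive element [z] of [N] is fixed by conjugation modulo the kernel,
    since conjugation preserves the signs in [N]. *)
Lemma gap_periodic : periodic N O.
Proof.
have nullC a : N a -> null O a -> core O a.
  move=> Na [Oa aV] g; split; first exact: NJ.
  by have := NJ g (subV sN Na) aV; gsimp.
have [z pz leastz] := gap_least; have [Nz zV] := pz.
have Cz g : core O (g^-1 * z^-1 * g * z).
  have Nc : N (g^-1 * z^-1 * g * z).
    by apply: (subM sN) => //; apply: normalJ => //; exact: subV.
  apply: nullC => //; split.
    have Nc' : N (z^-1 * (g * z * g^-1)).
      by apply: (subM sN (subV sN Nz)); exact: normalJV.
    have := NJ g Nc' (leastz _ _); gsimp; apply.
    by have := posJ g^-1 pz; gsimp.
  by have := leastz _ (posJ g pz); gsimp.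
have Oz : stabilizes O z.
  apply: (maximal_stabilizes mO) => x /(max_sub mO) Ox.
  have [c _] := core_null (Cz x).
  by have := coneM tO Ox c; gsimp.
exists z; split=> // a Na Oa.
have [n [an an1]] := stabilizes_floor mO Oz zV Oa.
exists n; apply: nullC.
  by apply: (subM sN) => //; apply/(subV sN)/(subX sN).
split=> //; apply: contrapT => anV; apply: an1.
rewrite expgSr; have := leastz (z ^- n * a); gsimp; apply; split=> //.
by apply: (subM sN) => //; apply/(subV sN)/(subX sN).
Qed.
End Periodic.
End Gap.

(** If the orbit of the base point under [N] does not cluster, it has a gap; either the
    gap contains a point, or its end is a successor of the base point. *)
Lemma clusters_or_periodic : clusters N O \/ periodic N O \/
  forall g, stabilizes O g.
Proof.
case: (pselect (clusters N O)) => [|/existsNP [f /not_implyP [fpos nacc]]].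
  by left.
right.
have gapf a : N a -> ~ O a^-1 -> O (f^-1 * a).
  by move=> Na aV; apply: contrapT => fa; apply: nacc; exists a.
case: (pselect (exists2 g, ~ O g^-1 & ~ O (f^-1 * g))) => [[g gV fg]|nog].
  by left; apply: (@gap_periodic f _ g) => //; exact: gap_same_sign_all gV fg.
right; apply: (least_positive_biinvariant mO fpos) => g gV.
by apply: contrapT => fg; apply: nog; exists g.
Qed.
End NormalSubgroup.
End Series.

(** * Periodic actions *)

Section PeriodicAction.
Variable G : groupType.
Implicit Types (x y z g h a b c f u v w : G) (n m k : nat).
Variables (P O N M : G -> Prop).
Hypothesis mO : maximal_cone P O.
Let tO := max_total mO.
Let sS := null_subgroup tO.
Let nC := core_normal tO.
Let sC := nC.1.
Hypothesis perN : periodic N O.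
Hypothesis nM : normal M.
Hypothesis commM : forall x y, M x -> M y -> N (x * y * x^-1 * y^-1).

Local Instance eqcore_equiv : RelationClasses.Equivalence _ := eqmod_equiv nC.
Local Instance eqcore_mul : Morphisms.Proper _ _ := eqmod_properM nC.
Local Instance eqcore_inv : Morphisms.Proper _ _ := eqmod_properV nC.
Local Infix "==~" := (eqmod (core O)) (at level 70).
Local Hint Extern 0 (eqmod _ _ _) => reflexivity : core.

Let eqcore_cone x y : x ==~ y -> O x -> O y.
Proof.
by move=> xy Ox; have [c _] := core_null xy; have := coneM tO Ox c; gsimp.
Qed.

(** Modulo the kernel of the action, a positive commutator [c] is a positive power of
    the central translation [z].  Hence [x y^2 = c^2 y^2 x] is at least
    [z^(p + q + 2)], for [z^p] and [z^q] the floors of [x] and [y^2], although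
    [x < z^(p + 1)] and [y^2 < z^(q + 1)].  With [y] instead of [y^2] the estimate
    would fail by a factor [z]. *)
Lemma periodic_commutator_pos x y : M x -> M y -> O x -> O y ->
  O (x * y * x^-1 * y^-1)^-1.
Proof.
move=> Mx My Ox Oy; have Nc := commM Mx My; move: Nc.
apply: contraPP; move cE: (x * y * x^-1 * y^-1) => c cV Nc.
have [z [Nz zV Cz gen _]] := perN.
have zC n g : z ^+ n * g ==~ g * z ^+ n.
  elim: n => [|n IH]; first by rewrite expg0 mul1g mulg1.
  have zg : z * g ==~ g * z by have := Cz g; rewrite /eqmod; gsimp.
  by rewrite expgSr -mulgA zg !mulgA IH.
have Oz : stabilizes O z.
  apply: (maximal_stabilizes mO) => g /(max_sub mO) Og.
  have [H _] := core_null (Cz g).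
  by have := coneM tO Og H; gsimp.
have [n zc] := gen c Nc (coneNV tO cV).
have n0 : (0 < n)%N.
  case: n zc => // /(_ 1) [_]; rewrite expg0; by gsimp.
have cz : c ==~ z ^+ n by apply: (RelationClasses.symmetry (R := eqmod (core O))).
have Oyy := coneM tO Oy Oy.
have [p [xp xp1]] := stabilizes_floor mO Oz zV Ox.
have [q [yq yq1]] := stabilizes_floor mO Oz zV Oyy.
have xyy : x * (y * y) ==~ z ^+ n * (z ^+ n * (y * y * x)).
  have -> : x * (y * y) = c * (y * (c * (y * x))) by rewrite -cE; gsimp.
  by rewrite cz !mulgA -(mulgA (z ^+ n)) -zC !mulgA.
have : O (z ^- (p + q).+2 * (x * (y * y))).
  have E : z ^+ (n.-1 + n.-1) * (z ^- q * (y * y) * (z ^- p * x)) ==~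
      z ^- (p + q).+2 * (x * (y * y)).
    move uE : (z ^- q * (y * y)) => u; move vE : (z ^- p * x) => v.
    rewrite xyy -[x](mulVKg (z ^+ p)) vE -[y * y](mulVKg (z ^+ q)) uE.
    have powE : z ^- (p + q).+2 * z ^+ n * z ^+ n * z ^+ q * z ^+ p =
        z ^+ (n.-1 + n.-1).
      rewrite -!mulgA -!expgnDr.
      have -> : (n + (n + (q + p)) = (p + q).+2 + (n.-1 + n.-1))%N by lia.
      by rewrite expgnDr mulKg.
    by rewrite -(mulgA _ u) (mulgA u) -(zC p u) !mulgA powE.
  apply: (eqcore_cone E); apply: (coneM tO); last exact: coneM.
  by apply: (coneX tO); apply: (coneNV tO).
have -> : (p + q).+2 = (p.+1 + q.+1)%N by lia.
move=> Ez; apply: yq1.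
have E : z ^- (p.+1 + q.+1) * (x * (y * y)) ==~ z ^- p.+1 * x * (z ^- q.+1 * (y * y)).
  move uE : (z ^- q.+1 * (y * y)) => u; move vE : (z ^- p.+1 * x) => v.
  rewrite -[x](mulVKg (z ^+ p.+1)) vE -[y * y](mulVKg (z ^+ q.+1)) uE.
  by rewrite -(mulgA _ v) (mulgA v) -(zC q.+1 v) !mulgA -(mulgA _ (z ^+ p.+1) (z ^+ q.+1))
    -expgnDr mulVg mul1g.
by have := coneM tO (coneN tO xp1) (eqcore_cone E Ez); gsimp.
Qed.

Lemma periodic_commutator x y : M x -> M y -> core O (x * y * x^-1 * y^-1).
Proof.
have sM := nM.1; have sN' := null_subgroup tO.
have pos a b : M a -> M b -> O a -> O b -> null O (a * b * a^-1 * b^-1).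
  move=> Ma Mb Oa Ob; split; last exact: periodic_commutator_pos.
  by have := periodic_commutator_pos Mb Ma Ob Oa; gsimp.
have [_ [_ _ _ _ nullC]] := perN.
have posC a b : M a -> M b -> O a -> O b -> core O (a * b * a^-1 * b^-1).
  by move=> Ma Mb Oa Ob; apply: nullC; [exact: commM|exact: pos].
have posl a b : M a -> M b -> O a -> core O (a * b * a^-1 * b^-1).
  move=> Ma Mb Oa; case: (tO) => _ /(_ b) [|Ob]; first exact: posC.
  have := normalJ b^-1 nC (subV sC (posC _ _ Ma (subV sM Mb) Oa Ob)); by gsimp.
move=> Mx My; case: (tO) => _ /(_ x) [|Ox]; first exact: posl.
have := normalJ x^-1 nC (subV sC (posl _ y (subV sM Mx) My Ox)); by gsimp.
Qed.

End PeriodicAction.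

(** * Actions without a gap *)

(** Up to reversal, every total preorder of [S] is coarser than one of finitely many
    conjugates of [P].  Here [P] and [R] are cones of [S] through their restrictions. *)
Definition finite_orbits (G : groupType) (S P : G -> Prop) :=
  exists L : seq G, (forall r, r \in L -> S r) /\
    forall R : G -> Prop, (forall x y, S x -> S y -> R x -> R y -> R (x * y)) ->
      (forall x, S x -> R x \/ R x^-1) ->
    exists2 r, r \in L &
      (forall x, S x -> P x -> R (r^-1 * x * r)) \/
      (forall x, S x -> P x -> R (r^-1 * x^-1 * r)).

Section Clustering.
Variable G : groupType.
Implicit Types (x y z g h a b c f u v w r : G) (n m k : nat).
Variables (P O N : G -> Prop) (F : seq G).
Hypothesis mO : maximal_cone P O.
Hypothesis iF : isolated_by P F.
Let tO := max_total mO.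
Let sS := null_subgroup tO.
Let nC := core_normal tO.
Let sC := nC.1.
Hypothesis nN : normal N.
Let sN := nN.1.
Hypothesis commN : forall x y, N x -> N y -> core O (x * y * x^-1 * y^-1).
Hypothesis accR : clusters N O.
Hypothesis accL : clusters N (fun x => O x^-1).
Hypothesis orbS : finite_orbits (null O) P.

Let SJ s x : null O s -> O x -> O (s * x * s^-1).
Proof. by move=> [Os OV] Ox; apply: coneM => //; apply: coneM. Qed.

Let swap x y : N x -> N y -> O (x * y) -> O (y * x).
Proof.
move=> Nx Ny Oxy; have [H _] := core_null (commN (subV sN Nx) (subV sN Ny)).
have [H' _] := core_null (commN Ny Nx).
by have := coneM tO H' Oxy; gsimp.
Qed.

Lemma min_in_N a b : N a -> N b -> ~ O a^-1 -> ~ O b^-1 ->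
  exists c, [/\ N c, ~ O c^-1, O (c^-1 * a) & O (c^-1 * b)].
Proof.
move=> Na Nb aV bV; case: (tO) => _ /(_ (a^-1 * b)) [ab|].
  by exists a; split=> //; rewrite mulVg; exact: cone1.
by gsimp => ba; exists b; split=> //; rewrite mulVg; exact: cone1.
Qed.

Lemma small_in_N (l : seq G) : (forall f, f \in l -> ~ O f^-1) ->
  (exists2 a, N a & ~ O a^-1) ->
  exists a, [/\ N a, ~ O a^-1 &
    forall f, f \in l -> ~ O (f^-1 * a) /\ ~ O (a * f^-1)].
Proof.
elim: l => [_ [a Na aV]|f l IH lpos exN]; first by exists a; split.
have [|//|b [Nb bV bl]] := IH.
  by move=> g gl; apply: lpos; rewrite inE gl orbT.
have fpos : ~ O f^-1 by apply: lpos; rewrite inE eqxx.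
have [a1 [Na1 a1V a1f]] := accR fpos.
have [|a2 [Na2 a2V a2f]] := accL (f := f^-1).
  by rewrite invgK.
have a2V' : ~ O a2^-1^-1 by move: a2V; rewrite invgK.
have [c1 [Nc1 c1V c1a c1b]] := min_in_N Na1 (subV sN Na2) a1V a2V'.
have [c [Nc cV cc1 cb]] := min_in_N Nc1 Nb c1V bV.
exists c; split=> // g.
have le e d : N e -> N d -> O (e^-1 * d) -> ~ O (g^-1 * d) -> ~ O (g^-1 * e).
  by move=> _ _ ed gd ge; apply: gd; have := coneM tO ge ed; gsimp.
have le' e d : N e -> N d -> O (e^-1 * d) -> ~ O (d * g^-1) -> ~ O (e * g^-1).
  move=> Ne Nd /(swap (subV sN Ne) Nd) ed dg eg; apply: dg.
  by have := coneM tO ed eg; gsimp.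
rewrite inE => /predU1P [gf|gl].
  have cN d : O (c1^-1 * d) -> O (c^-1 * d).
    by move=> c1d; have := coneM tO cc1 c1d; gsimp.
  split; first by apply: (le c a1) => //; [exact: cN|rewrite gf].
  apply: (le' c a2^-1) => //; [exact: subV|exact: cN|rewrite gf].
  by move: a2f; gsimp.
have [gb bg] := bl g gl.
by split; [exact: (le c b)|exact: (le' c b)].
Qed.

(** The stabilizer [S] of the base point acts near it through one of finitely
    many order types, up to conjugation by [r] in [S] and reversal.  So one of the
    points [r b] and [r b^-1] is moved weakly to the right by every positive element
    of [S].  It is so close to the base point that the strictly positive elements of
    [F] also move it to the right, and isolation says that the order seen from that
    point is the same. *)
Lemma small_stabilizes (L : seq G) : (forall r, r \in L -> null O r) ->
    (forall R : G -> Prop,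
      (forall x y, null O x -> null O y -> R x -> R y -> R (x * y)) ->
      (forall x, null O x -> R x \/ R x^-1) ->
    exists2 r, r \in L &
      (forall x, null O x -> P x -> R (r^-1 * x * r)) \/
      (forall x, null O x -> P x -> R (r^-1 * x^-1 * r))) ->
  forall b, N b -> ~ O b^-1 ->
    (forall r f, r \in L -> f \in F -> ~ O f^-1 ->
      ~ O (f^-1 * r * b) /\ ~ O (b * r^-1 * f^-1)) ->
  stabilizes O b.
Proof.
move=> LS orb b Nb bV small; have sY := stabilizes_subgroup O.
case: (iF) => oP FP iP; have Ob := coneNV tO bV.
pose R s := O (b^-1 * s * b).
have [||r rL H] := orb R.
- by move=> x y _ _ Rx Ry; have := coneM tO Rx Ry; rewrite /R; gsimp.
- by move=> x _; case: (tO) => _ /(_ (b^-1 * x * b)); rewrite /R; gsimp.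
have Sr := LS r rL; have Yr := null_stabilizes tO Sr; have SrV := subV sS Sr.
suff [c Yc bE] : exists2 c, stabilizes O c & b = r^-1 * c * r \/ b = r^-1 * c^-1 * r.
  by case: bE => ->; apply: (subM sY) => //; apply: (subM sY) => //; exact: (subV sY).
have ext c : (forall f, f \in F -> O (c^-1 * f * c)) -> stabilizes O c.
  move=> Fc; apply: (maximal_stabilizes mO) => x Px.
  by apply: (iP (fun x => O (c^-1 * x * c))) => //; exact: conj_cone.
case: H => H.
  exists (r * b * r^-1); last by left; gsimp.
  apply: ext => f fF; case: (pselect (O f^-1)) => fV.
    have := SJ Sr (H f (conj (max_sub mO (FP f fF)) fV) (FP f fF)).
    by rewrite /R; gsimp.
  have [+ _] := small r f rL fF fV; move/(coneN tO); gsimp => brf.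
  by have := SJ Sr (coneM tO (coneM tO brf Sr.1) Ob); gsimp.
exists (r * b^-1 * r^-1); last by right; gsimp.
apply: ext => f fF; case: (pselect (O f^-1)) => fV.
  have Sf : null O f by split=> //; apply/(max_sub mO)/FP.
  have Ss := subM sS (subM sS SrV Sf) Sr.
  have := H f Sf (FP f fF); rewrite /R; gsimp => bsb.
  have b'b : O (b^-1 * ((r^-1 * f * r)^-1 * b * (r^-1 * f * r))).
    by have := coneM tO bsb Ss.1; gsimp.
  have := swap (subV sN Nb) (normalJ (r^-1 * f * r) nN Nb) b'b => bb'.
  by have := SJ Sr (coneM tO Ss.1 bb'); gsimp.
have [_] := small r f rL fF fV; move/(coneN tO); gsimp => frb.
have Orb : O (r * b * r^-1) := SJ Sr Ob.
by have := coneM tO (coneM tO Orb frb) SrV.1; gsimp.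
Qed.

Lemma clusters_pos : exists2 a, N a & ~ O a^-1.
Proof.
have [f _ fpos] := isolated_meets_positive mO iF.
by have [a [Na aV _]] := accR fpos; exists a.
Qed.

(** The small positive elements of [N] stabilize [O], and the others are products of
    small ones: division by the powers of one of them leaves a small remainder. *)
Lemma N_stabilizes a : N a -> stabilizes O a.
Proof.
have [L [LS orb]] := orbS; have sY := stabilizes_subgroup O.
pose l := [seq f <- [seq r^-1 * f | r <- L, f <- F] ++ [seq f * r | r <- L, f <- F]
           | `[< ~ O f^-1 >]].
have [||a0 [Na0 a0V a0l]] := @small_in_N l.
- by move=> f; rewrite mem_filter => /andP [/asboolP].
- exact: clusters_pos.
have good b : N b -> ~ O b^-1 -> O (b^-1 * a0) -> stabilizes O b.
  move=> Nb bV ba; apply: (small_stabilizes LS orb) => // r f rL fF fV.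
  have Sr := LS r rL.
  have l1 : r^-1 * f \in l.
    rewrite mem_filter mem_cat (allpairs_f (fun r f => r^-1 * f) rL fF) andbT.
    apply/asboolP; exact: (cone_sposM tO (subV sS Sr).1).
  have l2 : f * r \in l.
    rewrite mem_filter mem_cat (allpairs_f (fun r f => f * r) rL fF) orbT andbT.
    apply/asboolP; exact: (cone_sposMl tO fV Sr.1).
  have [+ _] := a0l _ l1; have [_] := a0l _ l2; rewrite !invgM !invgK => afr fra.
  split=> [frb|brf].
    by apply: fra; have := coneM tO frb ba; gsimp.
  apply: afr; have := coneM tO (swap (subV sN Nb) Na0 ba) brf; by gsimp.
have Ya0 : stabilizes O a0 by apply: good => //; rewrite mulVg; exact: cone1.
suff pos b : N b -> O b -> stabilizes O b.
  move=> Na; case: (tO) => _ /(_ a) [Oa|Oa]; first exact: pos.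
  exact: (subVE sY (pos _ (subV sN Na) Oa)).
move=> Nb Ob; have [n [bn bn1]] := stabilizes_floor mO Ya0 a0V Ob.
rewrite -[b](mulVKg (a0 ^+ n)); apply: (subM sY); first exact: (subX sY).
case: (pselect (O (a0 ^- n * b)^-1)) => bnV; first exact: null_stabilizes.
apply: good => //.
  by apply: (subM sN) => //; apply: (subV sN); apply: (subX sN).
have := coneN tO bn1; rewrite expgSr; by gsimp.
Qed.

(** If [y = x] or [x^-1] moves the point [g] to the right, then it moves it beyond
    [g a] for some positive [a] in [N], and [t = g^-1 y g] commutes with [a] modulo the
    kernel.  So [t^k >= a^k] for all [k], where the powers of [a] are cofinal; but the
    powers of [y] fix the points [a^m], which are cofinal too. *)
Lemma commuting_core x : null O x ->
  (forall a, N a -> core O (x * a * x^-1 * a^-1)) -> core O x.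
Proof.
have half y g : null O y -> (forall a, N a -> core O (y * a * y^-1 * a^-1)) ->
  O (g^-1 * y * g)^-1.
  move=> Sy Cy; apply: contrapT => yg.
  have [a [Na aV ay]] := accR yg.
  have Ya := N_stabilizes Na.
  have [m gm] : exists m, O (g^-1 * a ^+ m) by exact: (stabilizes_cofinal mO Ya aV g).
  have [n an] := stabilizes_cofinal mO Ya aV (g^-1 * a ^+ m).
  move yE : (g^-1 * y * g) ay yg => t at_ tpos.
  have ta : core O (t * a * t^-1 * a^-1).
    have := normalJ g nC (Cy _ (normalJV g nN Na)); rewrite -yE; by gsimp.
  have ta' : eqmod (core O) (t^-1 * a^-1 * t) a^-1.
    by have := normalJ t nC (subV sC ta); rewrite /eqmod; gsimp.
  have pw k : O (a ^- k * t ^+ k).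
    elim: k => [|k IH]; first by rewrite !expg0; gsimp; exact: cone1.
    have dC := core_null (subV sC (normalJ (a ^+ k) nC (eqmodX nC k ta'))).
    have ta0 : O (a^-1 * t) by have := coneN tO at_; gsimp.
    move: dC; rewrite -conj_expg expVgn => -[d _].
    have := coneM tO (coneM tO ta0 d) IH; rewrite expgSr expgS; by gsimp.
  have [bound _] : null O ((a ^+ m)^-1 * y ^- n.+1 * a ^+ m).
    have sS' := subV sS (subX sS n.+1 Sy).
    have YS := subX (stabilizes_subgroup O) m Ya.
    split; first by apply: (YS _).1; case: sS'.
    by have := (YS (y ^+ n.+1)).1 (subX sS n.+1 Sy).1; gsimp.
  apply: aV; have := coneM tO (coneM tO (coneM tO (pw n.+1) gm) bound) an.
  by rewrite -yE -conj_expg expgSr; gsimp.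
move=> Sx Cx g; split.
  have := half x^-1 g (subV sS Sx); gsimp; apply=> a Na.
  by have := normalJ x nC (subV sC (Cx a Na)); gsimp.
exact: half.
Qed.

(** As [N] stabilizes [O], the commutators of [x] with [N] fix the base point.  They lie
    in [N], hence commute with [N] modulo the kernel, and act trivially by
    [commuting_core].  So [x] itself commutes with [N]. *)
Lemma null_core x : null O x -> core O x.
Proof.
move=> Sx; apply: commuting_core => // a Na.
have Ya := N_stabilizes Na.
have YSV c : null O c -> null O (a * c * a^-1).
  move=> [Oc cV]; split; first by apply/(Ya _); gsimp.
  by apply/(Ya _); gsimp.
apply: commuting_core.
  by have := subM sS Sx (YSV _ (subV sS Sx)); gsimp.
move=> b Nb; apply: commN => //.
have := subM sN (normalJV x nN Na) (subV sN Na); by gsimp.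
Qed.

Lemma clusters_biinvariant g : stabilizes O g.
Proof.
apply: (normal_null_biinvariant mO iF) => h s /null_core Cs; exact: Cs.
Qed.
End Clustering.

(** * Virtually solvable groups *)

(** What remains of virtual solvability: a normal series with abelian quotients down to
    the trivial group, from a term that contains a positive power of each element. *)
Definition solvable_series (G : groupType) (N : nat -> G -> Prop) :=
  [/\ forall i, normal (N i), forall i x, N i.+1 x -> N i x,
      forall i x y, N i x -> N i y -> N i.+1 (x * y * x^-1 * y^-1),
      exists m, forall x, N m x -> x = 1 &
      forall g, exists2 k, (0 < k)%N & N 0 (g ^+ k)].

Section SolvableSeries.
Variable G : groupType.
Variable N : nat -> G -> Prop.
Hypothesis serN : solvable_series N.

Let not_null (O : G -> Prop) i := exists2 x, N i x & ~ null O x.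
Let abelian_action (O : G -> Prop) i :=
  forall x y, N i x -> N i y -> core O (x * y * x^-1 * y^-1).

(** The last term that moves the base point: the commutators of its elements lie in
    the next term, which is normal and fixes the base point, hence all points. *)
Lemma series_abelian_action P O : maximal_cone P O ->
  exists i, not_null O i /\ abelian_action O i.
Proof.
move=> mO; have tO := max_total mO; case: serN => nN decN comN [m Nm] rootN.
have [f fO] := max_proper mO.
have N0 : not_null O 0.
  have [k k0 Nk] := rootN f; exists (f ^+ k) => // -[Ok _].
  by apply: fO; apply: cone_root Ok.
have Nm' : ~ not_null O m.
  move=> [x /Nm -> n1]; apply: n1; exact: (sub1 (null_subgroup tO)).
have [i [Ni Ni1]] : exists i, not_null O i /\ ~ not_null O i.+1.
  apply: contrapT => noi.
  have all i : not_null O i.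
    by elim: i => // i IH; apply: contrapT => ?; apply: noi; exists i.
  exact: Nm'.
exists i; split=> // x y Nx Ny g; apply: contrapT => ng; apply: Ni1.
exists (g^-1 * (x * y * x^-1 * y^-1) * g) => //.
by apply: (normalJ _ (nN _)); exact: comN.
Qed.

(** By [periodic_commutator] the term before [N i] would act by commuting maps, against
    the choice of [i].  So [i] is [0], and each element that fixes the base point has a
    power in [N 0], which acts trivially. *)
Lemma periodic_biinvariant P O F i : maximal_cone P O -> isolated_by P F ->
  periodic (N i) O -> not_null O i ->
  (forall j, (j < i)%N -> ~ (not_null O j /\ abelian_action O j)) ->
  forall g, stabilizes O g.
Proof.
move=> mO iF perN Ni mini; have tO := max_total mO.
case: serN => nN decN comN _ rootN.
case: i perN Ni mini => [|i] perN [x Nx nx] mini; last first.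
  case: (mini i); first by [].
  split; first by exists x => //; exact: decN.
  by move=> a b; apply: (periodic_commutator mO perN (nN i)); exact: comN.
apply: (normal_null_biinvariant mO iF) => g s [Os sV].
have [k k0 Nk] := rootN s; have [_ [_ _ _ _ nullC]] := perN.
have [|H1 H2] := nullC (s ^+ k) Nk _ g.
  by split; rewrite -?expVgn; exact: coneX.
move: H1 H2; rewrite conj_expg -expVgn => H1 H2.
by split; [exact: cone_root H1|exact: cone_root H2].
Qed.

(** The alternative of [clusters_or_periodic] is applied to [O] and to its reverse, to
    the first term of the series that moves the base point and acts by commuting maps. *)
Theorem maximal_cone_biinvariant (P O : G -> Prop) F n : maximal_cone P O -> isolated_by P F ->
  finite_orbits (null O) P -> chain_length (null O) n ->
  forall g, stabilizes O g.
Proof.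
move=> mO iF orbS chS; have tO := max_total mO.
have mO' := maximal_cone_inv mO; have iF' := isolated_by_inv iF.
pose O' x := O x^-1.
have nullE x : null O' x <-> null O x by rewrite /null /O' invgK; tauto.
have coreE x : core O' x <-> core O x.
  by split=> Cx g; apply/nullE.
have ex : exists i, `[< not_null O i /\ abelian_action O i >].
  by have [i Hi] := series_abelian_action mO; exists i; apply/asboolP.
case: (ex_minnP ex) => i /asboolP [Ni abi] mini {ex}.
have mini' j : (j < i)%N -> ~ (not_null O j /\ abelian_action O j).
  by move=> ji H; have := mini j (asboolT H); rewrite leqNgt ji.
have [x Nx nx] := Ni; case: (serN) => nN _ _ _ _.
have sN := (nN i).1.
have nposP (Q : G -> Prop) : total_cone Q -> ~ null Q x -> exists2 a, N i a & ~ Q a^-1.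
  move=> tQ nQ; case: (pselect (Q x^-1)) => Qx; last by exists x.
  case: (pselect (Q x)) => Qx'; first by case: nQ.
  by exists x^-1; [exact: subV|rewrite invgK].
have [accR|[perN|//]] := clusters_or_periodic mO (nN i) abi (nposP O tO nx) chS;
  last exact: periodic_biinvariant mO iF perN Ni mini'.
have [|||accL|[perN|biO]] := @clusters_or_periodic _ _ O' (N i) mO' (nN i) _ _ n _.
- by move=> a b Na Nb; apply/coreE; exact: abi.
- by apply: nposP; [exact: inv_cone|move/nullE].
- by move=> L sL dL LS; apply: chS => // y /LS /nullE.
- exact: (clusters_biinvariant mO iF (nN i) abi accR accL orbS).
- have biO : forall g, stabilizes O' g.
    apply: (periodic_biinvariant mO' iF' perN).
      by exists x => // /nullE.
    move=> j ji [[y Ny ny] abj]; apply: (mini' j ji); split.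
      by exists y => // /nullE.
    by move=> a b Na Nb; apply/coreE; exact: abj.
  by move=> g y; have := biO g y^-1; rewrite /O'; gsimp.
- by move=> g y; have := biO g y^-1; rewrite /O'; gsimp.
Qed.

End SolvableSeries.

(** * An element that inverts the maximal convex subgroup *)

(** The lexicographic preorder: [O] decides first, and [O'] decides inside [null O]. *)
Definition refine (G : groupType) (O O' : G -> Prop) x := ~ O x^-1 \/ O' x.

Lemma refine_cone (G : groupType) (O O' : G -> Prop) : total_cone O ->
  (forall x, O' x -> null O x) -> (forall x y, O' x -> O' y -> O' (x * y)) ->
  (forall x, null O x -> O' x \/ O' x^-1) -> total_cone (refine O O').
Proof.
move=> tO O'S O'M O'tot; split=> [x y [xV|O'x] [yV|O'y]|x].
- by left; apply: (cone_sposM tO) => //; exact: coneNV.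
- by left; apply: (cone_sposMl tO xV); case: (O'S y O'y).
- by left; apply: (cone_sposM tO _ yV); case: (O'S x O'x).
- by right; exact: O'M.
- case: (pselect (O x^-1)) => xV; last by left; left.
  case: (pselect (O x)) => Ox; last by right; left; rewrite invgK.
  by case: (O'tot x (conj Ox xV)); [left|right]; right.
Qed.

(** A maximal cone [O'] of the subgroup [S], for the order [P], whose quotient
    [S / null O'] is abelian of rank one. *)
Record abelian_top (G : groupType) (S P O' : G -> Prop) : Prop := AbelianTop {
  top_sub : forall x, O' x -> S x;
  top_mul : forall x y, O' x -> O' y -> O' (x * y);
  top_total : forall x, S x -> O' x \/ O' x^-1;
  top_pos : forall x, S x -> P x -> O' x;
  top_proper : exists2 x, S x & ~ O' x;
  top_max : forall R : G -> Prop,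
    (forall x y, S x -> S y -> R x -> R y -> R (x * y)) ->
    (forall x, S x -> R x \/ R x^-1) -> (forall x, S x -> P x -> R x) ->
    (forall x, S x -> R x -> O' x) \/ (forall x, S x -> R x);
  top_comm : forall x y, S x -> S y -> null O' (x * y * x^-1 * y^-1);
  top_rank : forall x y, S x -> S y -> ~ O' x^-1 -> ~ O' y^-1 ->
    exists k l, [/\ (0 < k)%N, (0 < l)%N & null O' (x ^+ k * y ^- l)] }.

Section NoInversion.
Variable G : groupType.
Implicit Types (x y z g h a b c d f s t u v w r : G) (i j n m k l : nat).
Variables (P O O' : G -> Prop) (F : seq G).
Hypothesis mO : maximal_cone P O.
Hypothesis iF : isolated_by P F.
Hypothesis biO : forall g, stabilizes O g.
Local Notation S := (null O).
Hypothesis topO' : abelian_top S P O'.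
(** Invariance of the top quotient of [S] under [G]; it is refuted in this section. *)
Hypothesis O'J : forall g x, O' x -> O' (g * x * g^-1).

Let O'S := top_sub topO'.
Let O'M := top_mul topO'.
Let O'tot := top_total topO'.
Let O'comm := top_comm topO'.
Let tO := max_total mO.
Let nS : normal S := null_normal mO biO.
Let sS := nS.1.

Local Notation Q := (refine O O').

Let QS x : S x -> Q x -> O' x. Proof. by case=> _ xV [/(_ xV)|]. Qed.

Let QO x : Q x -> O x.
Proof. by case=> [/(coneNV tO)//|/O'S []]. Qed.

Let tQ : total_cone Q := refine_cone tO O'S O'M O'tot.

Let QJ g x : Q x -> Q (g * x * g^-1).
Proof.
case=> [xV|O'x]; [left|by right; exact: O'J].
move=> xV'; apply: xV; apply/(biO g^-1); by move: xV'; gsimp.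
Qed.

Let PQ x : P x -> Q x.
Proof.
move=> Px; case: (pselect (O x^-1)) => xV; [right|by left].
by apply: (top_pos topO') => //; split=> //; exact: (max_sub mO).
Qed.

Local Notation C := (null Q).

Let nC : normal C.
Proof.
split; first exact: null_subgroup.
move=> g x [Qx xV]; split; first by have := QJ g^-1 Qx; gsimp.
by have := QJ g^-1 xV; gsimp.
Qed.
Let sC := nC.1.

Let CS x : C x -> S x.
Proof. by move=> [/QO ? /QO ?]. Qed.

Let CE x : C x <-> null O' x.
Proof.
split=> [Cx|[? ?]]; last by split; right.
by have Sx := CS Cx; case: Cx => ? ?; split; apply: QS => //; exact: subV.
Qed.

Let SP x : S x -> ~ Q x^-1 <-> ~ O' x^-1.
Proof. by move=> Sx; split=> + O'x; apply; [right|apply: (QS (subV sS Sx))]. Qed.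

Local Instance eqnull_equiv : RelationClasses.Equivalence _ := eqmod_equiv nC.
Local Instance eqnull_mul : Morphisms.Proper _ _ := eqmod_properM nC.
Local Instance eqnull_inv : Morphisms.Proper _ _ := eqmod_properV nC.
Local Instance eqnull_exp : Morphisms.Proper _ _ := eqmod_properX nC.
Local Infix "==~" := (eqmod C) (at level 70).
Local Hint Extern 0 (eqmod _ _ _) => reflexivity : core.

Let eqQ x y : x ==~ y -> Q x -> Q y.
Proof. by move=> [xy _] Qx; have := coneM tQ Qx xy; gsimp. Qed.

Let SC x y : S x -> S y -> x * y ==~ y * x.
Proof.
move=> Sx Sy; have /CE := O'comm (subV sS Sy) (subV sS Sx).
by rewrite /eqmod; gsimp.
Qed.

Let SXM x y n : S x -> S y -> (x * y) ^+ n ==~ x ^+ n * y ^+ n.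
Proof.
move=> Sx Sy; elim: n => [|n IH]; first by rewrite !expg0 mulg1.
rewrite !expgS IH -!mulgA (mulgA y) (SC Sy (subX sS n Sx)); by gsimp.
Qed.

Let SJ g x : S x -> S (g * x * g^-1). Proof. exact: normalJV. Qed.

Let commS x y : S (x * y * x^-1 * y^-1) := holder mO biO x y.

Let Srank x y : S x -> S y -> ~ Q x^-1 -> ~ Q y^-1 ->
  exists k l, [/\ (0 < k)%N, (0 < l)%N & x ^+ k ==~ y ^+ l].
Proof.
move=> Sx Sy /(SP Sx) xV /(SP Sy) yV.
have [k [l [k0 l0 /CE kl]]] := top_rank topO' Sx Sy xV yV.
exists k, l; split=> //.
have H : x ^+ k * y ^- l ==~ 1 by apply/(eqmod_sub nC).
by rewrite -[x ^+ k](mulgVK (y ^+ l)) H mul1g.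
Qed.

(** Otherwise [S] is central modulo [C].  Then [G / C] is abelian: a commutator is
    central and has a power which is trivial, since [G / S] has rank one, and [G / C] is
    torsion-free.  So [rank_one] applies to the preorder [Q], and provides a common
    power of an element of [S] and an element outside. *)
Lemma some_expansion :
  exists t s, [/\ S s, ~ Q s^-1 & ~ Q (t * s * t^-1 * s^-1)^-1].
Proof.
have CJ g x : C x -> C (g * x * g^-1) by exact: normalJV.
case: (pselect (forall g s, S s -> C (g * s * g^-1 * s^-1))) => [cen|].
  exfalso.
  have cenE g s : S s -> g * s ==~ s * g.
    by move=> Ss; have := subV sC (normalJ (g * s) nC (cen g s Ss));
       rewrite /eqmod; gsimp.
  have commC x y : C (x * y * x^-1 * y^-1).
    have pos a b : ~ O a^-1 -> ~ O b^-1 -> C (a * b * a^-1 * b^-1).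
      move=> aV bV; have [k [l [k0 l0 kl]]] :=
        rank_one tO commS (max_sub mO) iF aV bV.
      have := commS b a; move dE : (b * a * b^-1 * a^-1) => d Sd.
      have dk : d ^+ k ==~ 1.
        have H1 : (d * a) ^+ k ==~ d ^+ k * a ^+ k.
          elim: (k) => [|j IH]; first by rewrite !expg0 mulg1.
          by rewrite !expgS IH -!mulgA (mulgA a) (cenE a _ (subX sS j Sd)) !mulgA.
        have H2 : (d * a) ^+ k ==~ a ^+ k.
          have -> : d * a = b^-1^-1 * a * b^-1 by rewrite -dE; gsimp.
          move uE : (a ^+ k * b ^- l) kl => u Su.
          have akE : a ^+ k = u * b ^+ l by rewrite -uE mulgVK.
          rewrite -conj_expg akE invgK mulgA (cenE b u Su) -!mulgA.
          by rewrite (mulgA b) expgC mulgK.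
        move: H2; rewrite H1 => H2.
        by rewrite -[d ^+ k](mulgK (a ^+ k)) H2 mulgV.
      have /CE [dk1 dk2] := (eqmod_sub nC _).1 dk.
      suff : C d by move=> /(subV sC); rewrite -dE; gsimp.
      split; first by apply: (cone_root tQ k0); right.
      by apply: (cone_root tQ k0); rewrite expVgn; right.
    have posl a b : ~ O a^-1 -> C (a * b * a^-1 * b^-1).
      move=> aV; case: (pselect (O b^-1)) => bV; last exact: pos.
      case: (pselect (O b)) => Ob; first exact: cen.
      have := normalJ b^-1 nC (subV sC (pos a b^-1 aV _)); gsimp; exact.
    case: (pselect (O x^-1)) => xV; last exact: posl.
    case: (pselect (O x)) => Ox.
      have := subV sC (cen y x (conj Ox xV)); by gsimp.
    have := normalJ x^-1 nC (subV sC (posl x^-1 y _)); gsimp; exact.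
  have [s Ss sO] := top_proper topO'.
  have sV : ~ Q s^-1^-1 by rewrite invgK => /(QS Ss).
  have [f _ fpos] := isolated_meets_positive mO iF.
  have fQ : ~ Q f^-1 by move=> /QO.
  have [k [l [k0 l0 kl]]] := rank_one tQ commC PQ iF fQ sV.
  have : S (f ^+ k).
    rewrite -[f ^+ k](mulgVK (s^-1 ^+ l)); apply: (subM sS); first exact: CS.
    by apply: (subX sS); exact: subV.
  by case=> _; exact: cone_sposX.
move=> /existsNP [g /existsNP [s /not_implyP [Ss nCs]]].
have [s1 [Ss1 s1V nC1]] : exists s1, [/\ S s1, ~ Q s1^-1 & ~ C (g * s1 * g^-1 * s1^-1)].
  have nCs' : ~ C s.
    by move=> Cs; apply: nCs; apply: (subM sC (CJ g _ Cs)); exact: subV.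
  case: (pselect (Q s^-1)) => sV; last by exists s.
  exists s^-1; split; first exact: subV.
    by rewrite invgK => Qs; apply: nCs'.
  by move=> /(normalJ s^-1 nC)/(subV sC); gsimp.
case: (pselect (Q (g * s1 * g^-1 * s1^-1)^-1)) => eV; last by exists g, s1.
exists g^-1, s1; split=> // eV'; apply: nC1; split=> //.
have := QJ g eV'; gsimp => H.
by have := QJ s1 H; gsimp.
Qed.
Local Notation br x y := (x * y * x^-1 * y^-1).

Let brX t s n : S s -> br t s ^+ n ==~ br t (s ^+ n).
Proof.
move=> Ss; rewrite (SXM n (SJ t Ss) (subV sS Ss)) expVgn.
by have := conj_expg t^-1 s n; rewrite invgK => ->.
Qed.

Let brS x y : S (br x y). Proof. exact: commS. Qed.

(** Elements of [S] have common powers modulo [C], so if [t] expands one positive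
    element, it expands all of them. *)
Let br_mono t s s' : S s -> ~ Q s^-1 -> ~ Q (br t s)^-1 -> S s' -> ~ Q s'^-1 ->
  ~ Q (br t s')^-1.
Proof.
move=> Ss sV eV Ss' sV'.
have [k [l [k0 l0 kl]]] := Srank Ss' Ss sV' sV.
move=> Qe; apply: (cone_sposX tQ l0 eV).
apply: (eqQ (x := (br t s' ^+ k)^-1)).
  by rewrite (brX t k Ss') (brX t l Ss) kl.
by rewrite -expVgn; exact: coneX.
Qed.

(** [S / C] is archimedean because it has rank one. *)
Let archimedean v d : S v -> S d -> ~ Q v^-1 ->
  exists n0, forall n, (n0 <= n)%N -> Q (v ^+ n * d).
Proof.
move=> Sv Sd vV; have Qv := coneNV tQ vV.
case: (pselect (Q d)) => [Qd|dV].
  by exists 0 => n _; apply: (coneM tQ) => //; exact: coneX.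
have dV' : ~ Q d^-1^-1 by rewrite invgK.
have [k [[|l] [k0 // l0 kl]]] := Srank Sv (subV sS Sd) vV dV'.
exists k => n kn; rewrite -(subnK kn) expgnDr -mulgA; apply: (coneM tQ).
  exact: coneX.
apply: (eqQ (x := d^-1 ^+ l)).
  by rewrite kl expgSr mulgVK.
by apply: coneX => //; exact: (coneNV tQ dV').
Qed.

(** Every positive element outside of [S] expands [s] as [t] does, because it has
    a power in common with [t] modulo [S], and [S] commutes with [s]. *)
Let same_expansion t s f : ~ O t^-1 -> S s -> ~ Q (br t s)^-1 ->
  ~ O f^-1 -> ~ Q (br f s)^-1.
Proof.
move=> tV Ss eV fV Qf.
have [k [l [k0 l0 Su]]] := rank_one tO commS (max_sub mO) iF fV tV.
have Qfj j : Q (br (f ^+ j) s)^-1.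
  elim: j => [|j IH]; first by rewrite expg0; gsimp; exact: cone1.
  by have := coneM tQ Qf (QJ f IH); rewrite expgS; gsimp.
have Qtj j : (0 < j)%N -> ~ Q (br (t ^+ j) s)^-1.
  case: j => // j _; elim: j => [|j IH]; first by rewrite expg1.
  have := cone_sposM tQ (QJ t (coneNV tQ IH)) eV.
  by rewrite [t ^+ j.+2]expgS; gsimp.
apply: (Qtj l l0); move: Su (Qfj k).
move uE : (f ^+ k * t ^- l) => u Su.
have -> : f ^+ k = u * t ^+ l by rewrite -uE mulgVK.
apply: eqQ; apply: (eqmodV nC).
have -> : br (u * t ^+ l) s = u * (t ^+ l * s * t ^- l) * u^-1 * s^-1 by gsimp.
by rewrite (SC Su (SJ (t ^+ l) Ss)) mulgK.
Qed.

(** In the model case [G] is a group of affine maps of the line, with translations [S],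
    and [t] is an expansion.  There [br t f >= 1] says that [f] moves the fixed point of
    [t] to the right, and conjugating [t] by [x] in [S] translates that fixed point. *)
Let br_conj t x f : S x -> br (x * t * x^-1) f ==~ br t (br f x) * br t f.
Proof.
move=> Sx.
have -> : br (x * t * x^-1) f =
    x * (t * (x^-1 * (f * x * f^-1)) * t^-1) * br t f * (f * x^-1 * f^-1) by gsimp.
have Sfx := SJ f Sx; have SxV := subV sS Sx.
rewrite (SC SxV Sfx).
have uV : x * (f * x^-1 * f^-1) = (br f x)^-1 by gsimp.
have := brS t f; move: (SJ t (brS f x)); move: uV (brS f x).
move: (br t f) (br f x) (f * x^-1 * f^-1) => b u w uV Su; move aE : (t * u * t^-1) => a Sa Sb.
by rewrite (SC Sx Sa) -(mulgA a x) (SC Sx Sb) -!mulgA uV (SC Sb (subV sS Su)).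
Qed.

Let brV t s : S s -> br t s^-1 ==~ (br t s)^-1.
Proof.
move=> Ss; have -> : (br t s)^-1 = s * (t * s^-1 * t^-1) by gsimp.
by rewrite invgK (SC Ss (SJ t (subV sS Ss))).
Qed.

(** Conjugation of the expansion [t] by a large power of [s] sends its fixed point so
    far away that all elements of [F] move that point weakly to the right.  The elements
    that do so form a total cone [R], which contains [P] by isolation.  As [R]
    contains both [T n] and its inverse, and [T n] is not in [S], it is everything by
    maximality; but the negative translation [s0^-1] moves all points to the left. *)
Theorem no_inversion_absurd : False.
Proof.
have [t [s0 [Ss0 s0V eV]]] := some_expansion.
have tS : ~ S t.
  by move=> St; apply: eV; have /CE [] := O'comm St Ss0.
have [s [Ss sexp]] : exists s, S s /\ forall f, ~ O f^-1 -> ~ Q (br f s)^-1.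
  case: (pselect (O t^-1)) => tV; last first.
    by exists s0; split=> // f; exact: same_expansion tV Ss0 eV.
  exists s0^-1; split=> [|f]; first exact: subV.
  apply: (@same_expansion t^-1); first by rewrite invgK => Ot; apply: tS.
    exact: subV.
  move=> Qe; apply: eV; apply: eqQ (brV t Ss0) _.
  by have := QJ t Qe; gsimp.
pose T n := s ^+ n * t * s ^- n.
have TE n f : br (T n) f ==~ (br t (br f s)) ^+ n * br t f.
  by rewrite (br_conj t f (subX sS n Ss)) -(brX f n Ss) -(brX t n (brS f s)).
have [n Fn] : exists n, forall f, f \in F -> Q (br (T n) f).
  suff [n0 Hn] : exists n0, forall n, (n0 <= n)%N -> forall f, f \in F -> Q (br (T n) f).
    by exists n0; exact: Hn.
  case: (iF) => _ FP _; elim: (F) FP => [|f l IH] FP; first by exists 0.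
  have [|n1 H1] := IH; first by move=> g gl; apply: FP; rewrite inE gl orbT.
  have Pf : P f by apply: FP; rewrite inE eqxx.
  have [n2 H2] : exists n2, forall n, (n2 <= n)%N -> Q (br (T n) f).
    case: (pselect (O f^-1)) => fV.
      have Sf : S f by split=> //; exact: (max_sub mO).
      exists 0 => n _; apply: (eqQ (RelationClasses.symmetry (TE n f))).
      apply: (coneM tQ).
        apply: (coneX tQ); have CB : C (br f s) by apply/CE; exact: O'comm.
        have [? _] : C (br t (br f s)).
          by apply: (subM sC (normalJV t nC CB)); exact: subV.
        by [].
      case: (pselect (Q f^-1)) => fV'.
        have Cf : C f by split=> //; exact: PQ.
        by case: (subM sC (normalJV t nC Cf) (subV sC Cf)).
      exact: (coneNV tQ (br_mono Ss0 s0V eV Sf fV')).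
    have [n0 Hn] := archimedean (brS t (br f s)) (brS t f)
      (br_mono Ss0 s0V eV (brS f s) (sexp f fV)).
    by exists n0 => n nn; apply: (eqQ (RelationClasses.symmetry (TE n f))); exact: Hn.
  exists (maxn n1 n2) => n; rewrite geq_max => /andP [n1n n2n] g.
  by rewrite inE => /predU1P [->|]; [exact: H2|exact: H1].
pose R g := Q (br (T n) g).
have tR : total_cone R.
  split=> [x y Rx Ry|x].
    by have := coneM tQ Rx (QJ x Ry); rewrite /R; gsimp.
  case: (tQ) => _ /(_ (br (T n) x)) [|H]; first by left.
  by right; have := QJ x^-1 H; rewrite /R; gsimp.
have PR x : P x -> R x by case: (iF) => _ _ iP; apply: iP.
have R1 : R (T n) by rewrite /R; gsimp; exact: cone1.
have R2 : R (T n)^-1 by rewrite /R; gsimp; exact: cone1.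
case: (max_max mO tR PR) => [RO|RT].
  apply: tS; have ST : S (T n) by split; exact: RO.
  by have := normalJ (s ^+ n) nS ST; rewrite /T; gsimp.
have := RT s0^-1; rewrite /R => /(eqQ (TE n s0^-1)) Q1.
apply: eV; apply: eqQ Q1.
have CB : C (br s0^-1 s) by apply/CE; apply: O'comm => //; exact: subV.
have CB' : br t (br s0^-1 s) ==~ 1.
  by apply/(eqmod_sub nC); apply: (subM sC (normalJV t nC CB)); exact: subV.
by rewrite CB' expg1n mul1g; exact: brV.
Qed.

End NoInversion.

(** * From the maximal convex subgroup to the group *)

Section Extension.
Variable G : groupType.
Implicit Types (x y z g h a b c d f s t u v w r : G) (i j n m k l : nat).
Variables (P O : G -> Prop) (F : seq G).
Hypothesis mO : maximal_cone P O.
Hypothesis iF : isolated_by P F.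
Hypothesis biO : forall g, stabilizes O g.
Local Notation S := (null O).
Let tO := max_total mO.
Let nS : normal S := null_normal mO biO.
Let sS := nS.1.
Let commS x y : S (x * y * x^-1 * y^-1) := holder mO biO x y.

(** If no element inverts the order of [S], then by [finite_orbits] each [g] preserves
    it after correction by an inner automorphism of [S].  The top quotient of [S] is abelian,
    so it is invariant under [G], against [no_inversion_absurd]. *)
Lemma inverting_element : finite_orbits S P ->
  (forall x, S x -> x = 1) \/ (exists O', abelian_top S P O') ->
  exists2 h, ~ S h & forall s, S s -> P s -> P (h * s^-1 * h^-1).
Proof.
move=> [L [LS orb]] Stop; have [oP FP iP] := iF; have [tP antiP] := oP.
case: Stop => [S1|[O' tO']].
  have [f _ fV] := isolated_meets_positive mO iF.
  exists f => [[]//|s /S1 -> _].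
  by gsimp; exact: (cone1 tP).
apply: contrapT => noh.
have preserve g : exists2 r, S r &
    forall s, S s -> P s -> P (g * r^-1 * s * r * g^-1).
  have [||r rL H] := orb (fun s => P (g * s * g^-1)).
  - by move=> x y _ _ Px Py; have := coneM tP Px Py; gsimp.
  - by move=> x _; case: (tP) => _ /(_ (g * x * g^-1)); gsimp.
  exists r; first exact: LS.
  case: H => [H s Ss Ps|H]; first by have := H s Ss Ps; gsimp.
  exfalso; apply: noh; exists (g * r^-1); last first.
    by move=> s Ss Ps; have := H s Ss Ps; gsimp.
  move=> Sh; have inv s : S s -> P s -> P (g * r^-1 * s^-1 * (g * r^-1)^-1).
    by move=> Ss Ps; have := H s Ss Ps; gsimp.
  move: (g * r^-1) Sh inv => h Sh inv.
  have h1 : h = 1.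
    case: (tP) => _ /(_ h) [Ph|PhV].
      by apply: antiP => //; have := inv h Sh Ph; gsimp.
    by apply: antiP => //; have := inv h^-1 (subV sS Sh) PhV; gsimp.
  have [x Sx []] := top_proper tO'.
  case: (top_total tO' Sx) => // O'x.
  have only1 s : S s -> P s -> s = 1.
    by move=> Ss Ps; apply: antiP => //; have := inv s Ss Ps; rewrite h1; gsimp.
  case: (tP) => _ /(_ x) [Px|PxV]; first exact: (top_pos tO').
  rewrite -[x]invgK (only1 _ (subV sS Sx) PxV) invg1.
  by case: (top_total tO' (sub1 sS)); rewrite ?invg1.
have O'sub (m : G) : (forall s, S s -> P s -> P (m^-1 * s * m)) ->
    forall s, S s -> O' (m^-1 * s * m) -> O' s.
  move=> pm; have Sm x : S x -> S (m^-1 * x * m) by exact: normalJ.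
  have [x|x|x|//|all] := @top_max _ _ _ _ tO' (fun x => O' (m^-1 * x * m)).
  - by move=> y _ _ Ox Oy; have := top_mul tO' Ox Oy; gsimp.
  - by move=> /Sm/(top_total tO'); gsimp.
  - by move=> Sx Px; apply: (top_pos tO'); [exact: Sm|exact: pm].
  - have [x Sx []] := top_proper tO'.
    by have := all (m * x * m^-1) (normalJV m nS Sx); gsimp.
apply: (no_inversion_absurd mO iF biO tO').
move=> g x O'x; have Sx := top_sub tO' O'x.
have [r Sr pr] := preserve g.
have O'r : O' (r * x * r^-1).
  by have := top_mul tO' (top_comm tO' Sr Sx).1 O'x; gsimp.
apply: (O'sub (g * r^-1) _ _ (normalJV g nS Sx)); last first.
  by have := O'r; gsimp.
move=> s Ss Ps; case: (tP) => _ /(_ ((g * r^-1)^-1 * s * (g * r^-1))) [//|].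
have Sm := normalJ (g * r^-1) nS Ss.
move=> /(pr _ (subV sS Sm)); gsimp => PsV.
by rewrite (antiP s Ps PsV); gsimp; exact: (cone1 tP).
Qed.

(** After conjugation of [R] by one of finitely many [c], the positive part of [S] lies
    in [R]; it may be necessary to use [h] to reverse it.  Then [R] contains the whole coset
    [h' S] of [h' = h] or [h^-1]: if [s] is negative, write [h' s] as a positive
    conjugate times [h'].  Each element outside of [S] has a power in a coset [h'^l S],
    for some nonzero integer [l], so its sign in [R] is determined by its sign in [O]. *)
Lemma finite_orbits_extend : finite_orbits S P ->
  (exists2 h, ~ S h & forall s, S s -> P s -> P (h * s^-1 * h^-1)) ->
  finite_orbits (fun _ => True) P.
Proof.
move=> [L [LS orb]] [h hS inv]; have [oP FP iP] := iF; have [tP antiP] := oP.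
have invV s : S s -> P s -> P (h^-1 * s^-1 * h).
  move=> Ss Ps; case: (tP) => _ /(_ (h^-1 * s^-1 * h)) [//|]; gsimp => Pc.
  have := inv _ (normalJ h nS Ss) Pc; gsimp => PsV.
  by rewrite (antiP s Ps PsV); gsimp; exact: (cone1 tP).
exists (L ++ [seq h^-1 * r | r <- L] ++ [seq h^-1 * h^-1 * r | r <- L]).
split=> // R RM Rtot.
have tR : total_cone R by split=> [x y|x]; [exact: RM|exact: Rtot].
have [c cL cP] : exists2 c, c \in L ++ [seq h^-1 * r | r <- L] &
    forall s, S s -> P s -> R (c^-1 * s * c).
  have [||r rL [H|H]] := orb R.
  - by move=> x y _ _; exact: RM.
  - by move=> x _; exact: Rtot.
  - by exists r => //; rewrite mem_cat rL.
  exists (h^-1 * r); first by rewrite mem_cat map_f ?orbT.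
  move=> s Ss Ps; have := H _ (normalJV h nS (subV sS Ss)) (inv s Ss Ps).
  by gsimp.
have tRc := conj_cone tR c.
have [h' hh'] : exists h', [/\ ~ S h', R (c^-1 * h' * c) &
    forall s, S s -> P s -> P (h' * s^-1 * h'^-1)].
  case: (Rtot (c^-1 * h * c) I) => Rh; first by exists h.
  exists h^-1; split; [|by move: Rh; gsimp|].
    by move=> /(subV sS); rewrite invgK.
  by move=> s Ss Ps; rewrite invgK; exact: invV.
have {hh'} [hS' Rh inv'] := hh'.
have RhS s : S s -> R (c^-1 * (h' * s) * c).
  move=> Ss; case: (tP) => _ /(_ s) [Ps|Ps].
    exact: (coneM tRc Rh (cP s Ss Ps)).
  have := coneM tRc (cP _ (normalJV h' nS (subV sS (subV sS Ss))) (inv' _ (subV sS Ss) Ps)) Rh.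
  by gsimp.
have RhX l u : (0 < l)%N -> S u -> R (c^-1 * (h' ^+ l * u) * c).
  case: l => // l _ Su; rewrite expgSr -(mulgA _ h' u).
  exact: (coneM tRc (coneX tRc l Rh) (RhS u Su)).
have posR : (forall x, ~ O x^-1 -> R (c^-1 * x * c)) \/
    (forall x, ~ O x^-1 -> R (c^-1 * x^-1 * c)).
  case: (pselect (O h'^-1)) => hV; [right|left] => x xV.
    have hV' : ~ O h'^-1^-1 by rewrite invgK => Oh; apply: hS'.
    have [k [l [k0 l0 kl]]] := rank_one tO commS (max_sub mO) iF xV hV'.
    apply: (cone_root tRc k0).
    have := RhX l _ l0 (subV sS kl).
    by rewrite !expVgn; gsimp.
  have [k [l [k0 l0 kl]]] := rank_one tO commS (max_sub mO) iF xV hV.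
  apply: (cone_root tRc k0).
  by have := RhX l _ l0 (normalJ (h' ^+ l) nS kl); gsimp.
case: posR => posR.
  exists c; first by rewrite catA mem_cat cL.
  left=> x _ Px; case: (pselect (O x^-1)) => xV; last exact: posR.
  by apply: cP => //; split=> //; exact: (max_sub mO).
exists (h^-1 * c).
  rewrite mem_cat; apply/orP; right; move: cL; rewrite !mem_cat => /orP [cL|].
    by rewrite map_f.
  case/mapP => r rL ->; apply/orP; right.
  by apply/mapP; exists r => //; rewrite mulgA.
right=> x _ Px; case: (pselect (O x^-1)) => xV.
  have Sx : S x by split=> //; exact: (max_sub mO).
  have := cP _ (normalJV h nS (subV sS Sx)) (inv x Sx Px); by gsimp.
have xV' : ~ O (h * x * h^-1)^-1.
  by move=> Oh; apply/xV/(biO h^-1); move: Oh; gsimp.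
by have := posR _ xV'; gsimp.
Qed.

(** Let [j] be the last index whose term is not contained in [S].  The chain of
    intersections with [S] that skips the step at [j] has a torsion step.  If it
    comes after [j], it is a step of the given chain.  If it comes before, then
    both terms have nontrivial images in [G / S], which has rank one, and so the
    step of the given chain is torsion as well. *)
Lemma chain_length_extend n : chain_length S n -> chain_length (fun _ : G => True) n.+1.
Proof.
move=> chS L sL dL _ comL.
have dLE i j x : (i <= j)%N -> L j x -> L i x.
  by move=> /subnK <-; elim: (j - i)%N x => // d IH x Ld; apply: IH; apply: dL.
pose out j := exists2 z, L j z & ~ S z.
case: (pselect (out 0)) => [out0|in0]; last first.
  have [||i lin tors] := chS L sL dL _ _.
  - by move=> x Lx; apply: contrapT => nSx; apply: in0; exists x.
  - by move=> x y Lx Ly; apply: dL; exact: comL.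
  - by exists i => //; rewrite ltnS ltnW.
have [j [jn outj inj]] : exists j, [/\ (j <= n.+1)%N, out j &
    j = n.+1 \/ forall x, L j.+1 x -> S x].
  apply: contrapT => noj.
  have all j : (j <= n.+1)%N -> out j.
    elim: j => // j IH jn; apply: contrapT => nout; apply: noj.
    exists j; split; [exact: ltnW|exact: IH (ltnW jn)|right=> x Lx].
    by apply: contrapT => nSx; apply: nout; exists x.
  by apply: noj; exists n.+1; split=> //; [exact: all|left].
pose M i x := (if (i <= j)%N then L i x else L i.+1 x) /\ S x.
have [|i x|x [] //|x y|i lin tors] := chS M.
- move=> i; split.
  + by split; [case: ifP => _; exact: sub1|exact: sub1].
  + move=> x y [Lx Sx] [Ly Sy]; split; last exact: subM.
    by move: Lx Ly; case: ifP => _; exact: subM.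
  + move=> x [Lx Sx]; split; last exact: subV.
    by move: Lx; case: ifP => _; exact: subV.
- rewrite /M => -[Lx Sx]; split=> //; move: Lx.
  case: (leqP i.+1 j) => ij; first by rewrite (ltnW ij); exact: dL.
  by case: ifP => _ Lx; [exact: (dL _ _ (dL _ _ Lx))|exact: dL].
- rewrite /M !leq0n => -[Lx _] [Ly _]; split; last exact: commS.
  by case: ifP => _; [apply: dL|]; exact: comL.
have [z Lz zS] := outj.
case: (ltnP i j) => ij; last first.
  exists i.+1 => // x Lx.
  have Sx : S x.
    case: inj => [jE|inj]; first by move: jn ij lin; lia.
    by apply: inj; apply: dLE Lx.
  have [|m m0] := tors x.
    by split=> //; case: ifP => _ //; exact: dL.
  by rewrite /M ltnNge ij /= => -[Lm _]; exists m.
exists i; first exact: ltnW.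
have sD := sL i.+1.
have JD g d : L 0 g -> L i.+1 d -> L i.+1 (g * d * g^-1).
  move=> Lg Ld; have /(dLE i.+1 n.+1) := comL g d Lg (dLE 0 i.+1 d isT Ld).
  by move=> /(_ (leqW lin)) Lc; have := subM sD Lc Ld; gsimp.
have mulD y w m : L i y -> L i.+1 w -> L i.+1 (y ^+ m) -> L i.+1 ((y * w) ^+ m).
  move=> Ly Lw Lym; rewrite -[_ ^+ m](mulgVK (y ^+ m)); apply: (subM sD) => //.
  elim: m {Lym} => [|m IH]; first by rewrite !expg0; gsimp; exact: sub1.
  have Ly0 := dLE 0 i y isT Ly.
  have := subM sD IH (JD _ _ (subX (sL 0) m.+1 Ly0) Lw).
  by rewrite !expgSr; gsimp.
have [z' [Lz' zV]] : exists z', L i.+1 z' /\ ~ O z'^-1.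
  have Liz := dLE i.+1 j z ij Lz.
  case: (pselect (O z^-1)) => zV; last by exists z.
  exists z^-1; split; first exact: subV.
  by rewrite invgK => Oz; apply: zS.
have step y : L i y -> ~ O y^-1 -> exists2 m, (0 < m)%N & L i.+1 (y ^+ m).
  move=> Ly yV; have [k [l [k0 l0 kl]]] := rank_one tO commS (max_sub mO) iF yV zV.
  have [|m m0] := tors (y ^+ k * z' ^- l).
    rewrite /M (ltnW ij); split=> //; apply: (subM (sL i)); first exact: subX.
    by apply: subV => //; apply: subX => //; exact: dL.
  rewrite /M ij => -[Lm _]; exists (k * m)%N; first by rewrite muln_gt0 k0.
  rewrite expgnA -[y ^+ k](mulgVK (z' ^+ l)); apply: mulD => //.
    apply: (subM (sL i)); first exact: subX.
    by apply: subV => //; apply: subX => //; exact: dL.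
  exact: subX.
move=> x Lx; case: (pselect (O x^-1)) => xV; last exact: step.
case: (pselect (O x)) => Ox.
  have [|m m0] := tors x; first by rewrite /M (ltnW ij).
  by rewrite /M ij => -[Lm _]; exists m.
have [||m m0] := step x^-1; [exact: subV|by rewrite invgK|].
by rewrite expVgn => /(subV sD); rewrite invgK; exists m.
Qed.
End Extension.

(** * The structure of isolated orderings *)

Section Existence.
Variable G : groupType.
Implicit Types (x y z g h a b c d f s t : G).
Variables (P : G -> Prop) (F : seq G).
Hypothesis iF : isolated_by P F.

Lemma greatest_in (l : seq G) f0 : f0 \in l ->
  exists2 f, f \in l & forall g, g \in l -> P (g^-1 * f).
Proof.
have [[tP _] _ _] := iF.
elim: l f0 => // a l IH f0 _; case: l IH => [|b l] IH.
  exists a; first by rewrite inE.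
  by move=> g; rewrite inE => /eqP ->; gsimp; exact: (cone1 tP).
have [f fl fmax] := IH b (mem_head _ _).
case: (tP) => _ /(_ (a^-1 * f)) [af|].
  exists f; first by rewrite inE fl orbT.
  by move=> g; rewrite inE => /predU1P [->|/fmax].
gsimp => fa; exists a; first exact: mem_head.
move=> g; rewrite inE => /predU1P [->|/fmax gf]; first by gsimp; exact: (cone1 tP).
by have := coneM tP gf fa; gsimp.
Qed.

(** A total cone above [P] whose null subgroup contains the largest element of
    [F] is improper: its inverse is another total cone that contains [F].  The
    union of the others is the maximal one. *)
Lemma maximal_cone_exists : (exists x, x <> 1) -> exists O, maximal_cone P O.
Proof.
move=> [x0 x0n1]; have [[tP antiP] FP iP] := iF.
have [f1 f1F f1V] : exists2 f, f \in F & ~ P f^-1.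
  apply: contrapT => nof.
  have PV x : P x -> P x^-1.
    apply: (iP (fun x => P x^-1)) => [|f fF]; first exact: inv_cone.
    by apply: contrapT => fV; apply: nof; exists f.
  case: (tP) => _ /(_ x0) [Px|PxV]; apply: x0n1.
    by apply: antiP => //; exact: PV.
  by apply: antiP => //; have := PV _ PxV; rewrite invgK.
have [f fF fmax] := greatest_in f1F.
have fV : ~ P f^-1.
  by move=> Pf; apply: f1V; have := coneM tP (fmax _ f1F) Pf; gsimp.
pose above R := total_cone R /\ forall x, P x -> R x.
have improper R : above R -> R f^-1 -> forall x, R x.
  move=> [tR PR] Rf; have PRV x : P x -> R x^-1.
    apply: (iP (fun x => R x^-1)) => [|g gF]; first exact: inv_cone.
    by have := coneM tR (PR _ (fmax g gF)) Rf; gsimp.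
  move=> x; case: (tP) => _ /(_ x) [/PR//|/PRV]; by rewrite invgK.
have nested R1 R2 : above R1 -> above R2 ->
    (forall x, R1 x -> R2 x) \/ (forall x, R2 x -> R1 x).
  move=> [tR1 PR1] [tR2 PR2].
  case: (pselect (forall x, R1 x -> R2 x)) => [|/existsNP [x /not_implyP [R1x R2x]]].
    by left.
  right=> y R2y; case: (tP) => _ /(_ (y * x^-1)) [/PR1 yx|].
    by have := coneM tR1 yx R1x; gsimp.
  by gsimp => /PR2 xy; case: R2x; have := coneM tR2 xy R2y; gsimp.
pose O x := exists2 R, above R /\ ~ R f^-1 & R x.
have aP : above P by [].
exists O; split.
- split=> [x y [R1 [aR1 R1f] R1x] [R2 [aR2 R2f] R2y]|x].
    case: (nested R1 R2 aR1 aR2) => sub.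
      by exists R2 => //; apply: (coneM aR2.1) => //; exact: sub.
    by exists R1 => //; apply: (coneM aR1.1) => //; exact: sub.
  by case: (tP) => _ /(_ x) [Px|Px]; [left|right]; exists P.
- by move=> x Px; exists P.
- by exists f^-1 => -[R [_ Rf]].
- move=> R tR PR; case: (pselect (R f^-1)) => Rf; last first.
    by left=> x Rx; exists R.
  by right; apply: improper.
Qed.
End Existence.

Section SubgroupType.
Variables (G : groupType) (S : G -> Prop) (sS : subgroup S).

Definition subgroup_pred of subgroup S : {pred G} := fun x => `[< S x >].

Lemma subgroup_predM : mulg_closed (subgroup_pred sS).
Proof. by move=> x y /asboolP Sx /asboolP Sy; apply/asboolP; exact: subM. Qed.
Lemma subgroup_pred1 : 1 \in subgroup_pred sS.
Proof. by apply/asboolP; exact: sub1. Qed.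
Lemma subgroup_predV : invg_closed (subgroup_pred sS).
Proof. by move=> x /asboolP Sx; apply/asboolP; exact: subV. Qed.

HB.instance Definition _ := isMulClosed.Build G (subgroup_pred sS) subgroup_predM.
HB.instance Definition _ := isMul1Closed.Build G (subgroup_pred sS) subgroup_pred1.
HB.instance Definition _ := isInvClosed.Build G (subgroup_pred sS) subgroup_predV.

Definition subgroup_closed : groupClosed G := subgroup_pred sS.

Local Notation T := (sub_of subgroup_closed).

Lemma subgroup_typeP (t : T) : S (val t).
Proof. exact/asboolP/(valP t). Qed.

Definition in_subgroup x (Sx : S x) : T := Sub x (asboolT Sx).

Lemma val_in_subgroup x (Sx : S x) : val (in_subgroup Sx) = x.
Proof. exact: SubK. Qed.

Lemma valX (t : T) n : val (t ^+ n) = val t ^+ n.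
Proof. exact: gmulfXn. Qed.

Lemma valV (t : T) : val t^-1 = (val t)^-1.
Proof. exact: gmulfV. Qed.

Lemma valXV (t : T) n : val (t ^- n) = val t ^- n.
Proof. exact: gmulfXVn. Qed.

Lemma subgroup_finite_orbits (P : G -> Prop) :
  finite_orbits (fun _ : T => True) (fun t => P (val t)) -> finite_orbits S P.
Proof.
move=> [L [_ orb]]; exists [seq val t | t <- L]; split.
  by move=> _ /mapP [t _ ->]; exact: subgroup_typeP.
move=> R RM Rtot; have [||t tL H] := orb (fun t => R (val t)).
- by move=> x y _ _ Rx Ry; rewrite valM; apply: RM => //; exact: subgroup_typeP.
- by move=> x _; rewrite gmulfV; apply: Rtot; exact: subgroup_typeP.
exists (val t); first exact: map_f.
case: H => H; [left|right] => x Sx Px;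
  by have := H (in_subgroup Sx) I; rewrite ?(valM, gmulfV, val_in_subgroup); apply.
Qed.

Lemma subgroup_chain_length n :
  chain_length (fun _ : T => True) n -> chain_length S n.
Proof.
move=> chT L sL dL LS comL.
have [||||i lin tors] := chT (fun i t => L i (val t)).
- move=> i; split=> [|x y Lx Ly|x Lx]; rewrite ?(val1, valM, gmulfV).
  + exact: sub1.
  + exact: subM.
  + exact: subV.
- by move=> i x; exact: dL.
- by [].
- by move=> x y Lx Ly; rewrite !(valM, gmulfV); exact: comL.
exists i => // x Lx.
have Sx : S x.
  apply: LS; elim: (i) x Lx {lin tors} => // j IH x Lx; exact/IH/dL.
have [|m m0] := tors (in_subgroup Sx); first by rewrite val_in_subgroup.
by rewrite valX val_in_subgroup; exists m.
Qed.

Lemma subgroup_abelian_top (P : G -> Prop) (O' : T -> Prop) :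
  abelian_top (fun _ : T => True) (fun t => P (val t)) O' ->
  abelian_top S P (fun x => exists2 t : T, val t = x & O' t).
Proof.
case=> _ O'M O'tot O'P O'pr O'max O'comm O'rank.
have inS x (Sx : S x) : O' (in_subgroup Sx) <-> exists2 t : T, val t = x & O' t.
  split; first by exists (in_subgroup Sx) => //; rewrite val_in_subgroup.
  move=> [t tx O't]; suff -> : in_subgroup Sx = t by [].
  by apply: val_inj; rewrite val_in_subgroup.
split.
- by move=> _ [t <- _]; exact: subgroup_typeP.
- by move=> _ _ [t <- Ot] [u <- Ou]; exists (t * u); [rewrite valM|exact: O'M].
- move=> x Sx; case: (O'tot (in_subgroup Sx) I) => H; [left|right].
    exact/(inS x Sx).
  by exists (in_subgroup Sx)^-1 => //; rewrite gmulfV val_in_subgroup.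
- by move=> x Sx Px; apply/(inS x Sx)/O'P => //; rewrite val_in_subgroup.
- have [t _ Ot] := O'pr; exists (val t); first exact: subgroup_typeP.
  by move=> [u /val_inj ->].
- move=> R RM Rtot PR; case: (O'max (fun t => R (val t))).
  + by move=> x y _ _; rewrite valM; apply: RM; exact: subgroup_typeP.
  + by move=> x _; rewrite gmulfV; apply: Rtot; exact: subgroup_typeP.
  + by move=> x _; apply: PR; exact: subgroup_typeP.
  + move=> sub; left=> x Sx Rx; apply/(inS x Sx); apply: sub; first by [].
    exact: Rx.
  + by move=> all; right=> x Sx; have := all (in_subgroup Sx) I; rewrite val_in_subgroup.
- move=> x y Sx Sy.
  have [c1 c2] := O'comm (in_subgroup Sx) (in_subgroup Sy) I I.
  split; [move: c1|move: c2] => c; eexists; try exact: c.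
    by rewrite !(valM, gmulfV, val_in_subgroup).
  by rewrite !(gmulfV, valM, val_in_subgroup).
- move=> x y Sx Sy xV yV.
  have [||k [l [k0 l0 [c1 c2]]]] := O'rank (in_subgroup Sx) (in_subgroup Sy) I I.
  + move=> H; apply: xV; by exists (in_subgroup Sx)^-1.
  + move=> H; apply: yV; by exists (in_subgroup Sy)^-1.
  exists k, l; split=> //; split; [move: c1|move: c2] => c; eexists; try exact: c.
    by rewrite valM valXV valX !val_in_subgroup.
  by rewrite valV valM valXV valX !val_in_subgroup.
Qed.

Lemma subgroup_series (N : nat -> G -> Prop) : solvable_series N ->
  solvable_series (fun i (t : T) => N i (val t)).
Proof.
case=> nN dN cN [m Nm] rN; split.
- move=> i; split; first split.
  + by rewrite val1; exact: (sub1 (nN i).1).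
  + by move=> x y; rewrite valM; exact: (subM (nN i).1).
  + by move=> x; rewrite gmulfV; exact: (subV (nN i).1).
  + by move=> g x Nx; rewrite !valM gmulfV; exact: normalJ.
- by move=> i x; exact: dN.
- by move=> i x y Nx Ny; rewrite !(valM, gmulfV); exact: cN.
- by exists m => x /Nm x1; apply: val_inj; rewrite val1.
- by move=> g; have [k k0 Nk] := rN (val g); exists k => //; rewrite valX.
Qed.

End SubgroupType.

(** A preorder of the convex subgroup extends by [refine] to one of [G].  The elements of
    [F] outside of the subgroup remain positive, so only the others are needed, and
    some element of [F] is outside by [isolated_meets_positive]. *)
Lemma null_isolated (G : groupType) (P O : G -> Prop) (F : seq G)
    (mO : maximal_cone P O) (sS : subgroup (null O)) : isolated_by P F ->
  exists2 F' : seq (sub_of (subgroup_closed sS)), (size F' < size F)%N &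
    isolated_by (fun t => P (val t)) F'.
Proof.
move=> iF; have tO := max_total mO; have [[tP antiP] FP iP] := iF.
have [f fF fV] := isolated_meets_positive mO iF.
exists (pmap insub F).
  rewrite size_pmap_sub -(count_predC (mem (subgroup_closed sS)) F).
  rewrite -[X in (X < _)%N]addn0 ltn_add2l -has_count; apply/hasP; exists f => //.
  by apply/negP => /asboolP [].
split.
- split; first split=> [x y|x].
  + by rewrite valM; exact: coneM.
  + by rewrite gmulfV; case: tP.
  + move=> x; rewrite gmulfV => Px PxV; apply: val_inj; rewrite val1; exact: antiP.
- by move=> t; rewrite mem_pmap_sub => /FP.
move=> R tR FR t Pt.
pose O' x := exists2 u : sub_of (subgroup_closed sS), val u = x & R u.
have tQ : total_cone (refine O O').
  apply: refine_cone => //.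
  - by move=> _ [u <- _]; exact: subgroup_typeP.
  - by move=> _ _ [u <- Ru] [v <- Rv]; exists (u * v); [rewrite valM|exact: coneM].
  - move=> x Sx; case: tR => _ /(_ (in_subgroup sS Sx)) [Rx|Rx]; [left|right].
      by exists (in_subgroup sS Sx) => //; rewrite val_in_subgroup.
    by exists (in_subgroup sS Sx)^-1 => //; rewrite gmulfV val_in_subgroup.
have [|xV|[u /val_inj -> //]] := iP _ tQ _ (val t) Pt.
  move=> g gF; case: (pselect (O g^-1)) => gV; [right|by left].
  have Sg : null O g by split=> //; apply/(max_sub mO)/FP.
  exists (in_subgroup sS Sg); first by rewrite val_in_subgroup.
  by apply: FR; rewrite mem_pmap_sub val_in_subgroup.
by case: xV; have [] := subgroup_typeP t.
Qed.

(** Induction on the size of [F], which decreases from [G] to its maximal convex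
    subgroup; the subgroup is turned into a group type to apply the induction. *)
Theorem isolated_structure (G : groupType) (P : G -> Prop) (F : seq G)
    (N : nat -> G -> Prop) : isolated_by P F -> solvable_series N ->
  [/\ (forall x : G, x = 1) \/ (exists O, abelian_top (fun _ => True) P O),
      finite_orbits (fun _ => True) P & exists n, chain_length (fun _ : G => True) n].
Proof.
have [k] := ubnP (size F); elim: k G P F N => // k IH G P F N sF iF serN.
case: (pselect (exists x : G, x <> 1)) => [/(maximal_cone_exists iF) [O mO]|triv]; last first.
  have triv1 x : x = 1 :> G.
    by apply: contrapT => x1; apply: triv; exists x.
  split; first by left.
  - exists [:: 1]; split=> // R RM Rtot; exists 1; first by rewrite inE.
    left=> x _ _.
    rewrite (triv1 (_ * _ * _)); case: (Rtot 1 I) => //.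
    by rewrite invg1.
  - exists 1%N => L sL _ _ _; exists 0 => // x _; exists 1%N => //.
    by rewrite (triv1 (_ ^+ _)); exact: sub1.
have tO := max_total mO; have sS := null_subgroup tO.
have [F' sF' iF'] := null_isolated mO sS iF.
have [|topS /subgroup_finite_orbits orbS [n /subgroup_chain_length chS]] :=
    IH _ _ F' _ _ iF' (subgroup_series sS serN).
  by apply: leq_trans sF' _; rewrite -ltnS.
have biO := maximal_cone_biinvariant serN mO iF orbS chS.
have commO := holder mO biO.
split.
- right; exists O; split=> //.
  + by move=> x y; exact: coneM.
  + by move=> x _; case: tO.
  + by move=> x _; exact: (max_sub mO).
  + by have [x Ox] := max_proper mO; exists x.
  + move=> R RM Rtot PR; case: (@max_max _ _ _ mO R).
    * by split=> [x y|x]; [exact: RM|exact: Rtot].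
    * by move=> x; exact: PR.
    * by move=> sub; left=> x _; exact: sub.
    * by move=> all; right=> x _; exact: all.
  + by move=> x y _ _; exact: (rank_one tO commO (max_sub mO) iF).
- apply: (finite_orbits_extend mO iF biO orbS).
  apply: (inverting_element mO iF biO orbS).
  case: topS => [triv|[O' /subgroup_abelian_top tO']]; [left|right; eexists; exact: tO'].
  move=> x Sx; have := triv (in_subgroup sS Sx).
  by move/(congr1 val); rewrite val_in_subgroup val1.
- by exists n.+1; apply: (chain_length_extend mO iF biO).
Qed.

(** * Derived series and finite-dimensional spaces *)

Import GRing.Theory.
Local Open Scope classical_set_scope.
Local Open Scope quotient_scope.
Local Open Scope group_scope.

Section DerivedCores.
Variables (G : groupType) (H : groupClosed G).
Implicit Types (x y g : G).

(** Among the first powers of [x], two lie in the same coset of [H]; the factorial makes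
    the exponent independent of [x]. *)
Lemma finite_index_exponent : finite_index H ->
  exists2 k, (0 < k)%N & forall x, x ^+ k \in H.
Proof.
move=> /finite_fsetP [X HX]; pose n := #|` X|.
exists (n`!); first exact: fact_gt0.
move=> x; pose cosets := [seq left_coset H (x ^+ i) | i <- iota 0 n.+1].
have nuniq : ~~ uniq cosets.
  apply/negP => u; have /uniq_leq_size : {subset cosets <= X}.
    move=> _ /mapP [i _ ->]; have : [set` X] (left_coset H (x ^+ i)).
      by rewrite -HX; exists (x ^+ i).
    by [].
  by move=> /(_ u); rewrite size_map size_iota ltnn.
have [i [j [ij jn eqc]]] := uniqPn set0 nuniq.
rewrite size_map size_iota in jn.
move: eqc; rewrite !(nth_map 0) ?size_iota //; last exact: ltn_trans jn.
rewrite !nth_iota ?add0n //; last exact: ltn_trans jn.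
move=> eqc; have : left_coset H (x ^+ j) (x ^+ j).
  by rewrite /left_coset /= mulVg gpred1.
rewrite -eqc /left_coset /= => xH.
have {}xH : x ^+ (j - i) \in H.
  by move: xH; rewrite -{1}(subnKC (ltnW ij)) expgnDr mulKg.
have /dvdnP [q ->] : (j - i %| n`!)%N.
  apply: dvdn_fact; rewrite subn_gt0 ij /=; apply: leq_trans (leq_subr _ _) _.
  by rewrite -ltnS.
by rewrite mulnC expgnA gpredXn.
Qed.

(** The normal core of a term of the derived series. *)
Definition derived_core i x := forall g, g^-1 * x * g \in derived_series H i.

Lemma derived_core_series : finite_index H -> solvable_subgroup H ->
  solvable_series derived_core.
Proof.
move=> fiH [n solH]; split.
- move=> i; split; first split.
  + by move=> g; gsimp; exact: gpred1.
  + by move=> x y Nx Ny g; have := gpredM _ _ (Nx g) (Ny g); gsimp.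
  + by move=> x Nx g; have := Nx g; rewrite -gpredV; gsimp.
  + by move=> g x Nx h; have := Nx (g * h); gsimp.
- by move=> i x Nx g; apply: commutator_sub; exact: (Nx g).
- move=> i x y Nx Ny g.
  have := @mem_commutator _ (derived_series H i) _ _
    (etrans (gpredV _ _) (Nx g)) (etrans (gpredV _ _) (Ny g)).
  by rewrite /commg /conjg; gsimp.
- by exists n => x /(_ 1); rewrite invg1 mul1g mulg1; exact: solH.
- have [k k0 Hk] := finite_index_exponent fiH.
  by move=> x; exists k => // g; rewrite conj_expg.
Qed.

End DerivedCores.

Section LinearSpan.
Local Open Scope ring_scope.
Variables (K : fieldType) (V : lmodType K).
Implicit Types (u v w : V) (l : seq V) (c : K).

Fixpoint spanned l v : Prop :=
  if l is w :: l' then exists c, spanned l' (v - c *: w) else v = 0.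

Fixpoint independent l : Prop :=
  if l is w :: l' then ~ spanned l' w /\ independent l' else True.

Lemma spannedB l u v : spanned l u -> spanned l v -> spanned l (u - v).
Proof.
elim: l u v => /= [u v -> ->|w l IH u v [c Su] [d Sv]]; first by rewrite subr0.
exists (c - d); have := IH _ _ Su Sv; congr spanned.
by rewrite scalerBl !opprB addrACA [RHS]addrACA [- v + _]addrC.
Qed.

Lemma spannedZ l c u : spanned l u -> spanned l (c *: u).
Proof.
elim: l u => /= [u ->|w l IH u [d Su]]; first by rewrite scaler0.
by exists (c * d); rewrite -scalerA -scalerBr; exact: IH.
Qed.

Lemma spanned0 l : spanned l 0.
Proof.
elim: l => //= w l IH; exists 0; by rewrite scale0r subr0.
Qed.

Lemma spanned_mem_head w l : spanned (w :: l) w.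
Proof. by exists 1; rewrite scale1r subrr; exact: spanned0. Qed.

Lemma spanned_cons w l v : spanned l v -> spanned (w :: l) v.
Proof. by exists 0; rewrite scale0r subr0. Qed.

Definition combination l (r : 'rV[K]_(size l)) : V :=
  \sum_(i < size l) r 0 i *: l`_i.

Lemma combination_cons w l (r : 'rV[K]_(size l).+1) :
  @combination (w :: l) r =
    r 0 ord0 *: w + combination (\row_i r 0 (lift ord0 i)).
Proof.
rewrite /combination big_ord_recl /=; congr (_ + _).
by apply: eq_bigr => i _; rewrite mxE.
Qed.

Lemma combination_spanned l (r : 'rV[K]_(size l)) : spanned l (combination r).
Proof.
elim: l r => [r|w l IH r]; first by rewrite /combination big_ord0.
by rewrite combination_cons; exists (r 0 ord0); rewrite addrC addKr.
Qed.

Lemma spanned_combination l v : spanned l v -> exists r, @combination l r = v.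
Proof.
elim: l v => [v -> | w l IH v [c /IH [r rE]]].
  by exists 0; rewrite /combination big_ord0.
exists (\row_i oapp (r 0) c (unlift ord0 i)).
rewrite combination_cons mxE unlift_none /=.
have -> : \row_i (\row_i0 oapp (r 0) c (unlift ord0 i0)) 0 (lift ord0 i) = r.
  by apply/rowP => i; rewrite !mxE liftK.
by rewrite rE addrC subrK.
Qed.

Lemma combination_eq0 l (r : 'rV[K]_(size l)) :
  independent l -> combination r = 0 -> r = 0.
Proof.
elim: l r => [r _ _|w l IH r [nw indl]]; first by apply/rowP => -[].
rewrite combination_cons => r0.
have r00 : r 0 ord0 = 0.
  apply: contrapT => /eqP rn0; apply: nw.
  move/eqP: r0; rewrite addr_eq0 => /eqP/(congr1 (GRing.scale (r 0 ord0)^-1)).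
  rewrite scalerA mulVf // scale1r scalerN -scaleNr => ->.
  exact/spannedZ/combination_spanned.
have r'0 := IH _ indl; move: r0; rewrite r00 scale0r add0r => /r'0 {}r'0.
apply/rowP => i; rewrite mxE; case: (unliftP ord0 i) => [k|] -> //.
by have /rowP /(_ k) := r'0; rewrite !mxE.
Qed.

Lemma finite_dim_independent n :
  (forall l, independent l -> (size l <= n)%N) -> finite_dim V.
Proof.
move=> bound.
have [l [indl spanl]] : exists l, independent l /\ forall v, spanned l v.
  apply: contrapT => nol.
  have long k : exists2 l, size l = k & independent l.
    elim: k => [|k [l sl il]]; first by exists [::].
    have [v nv] : exists v, ~ spanned l v.
      by apply: contrapT => nv; apply: nol; exists l; split=> // v;
         apply: contrapT => Sv; apply: nv; exists v.
    by exists (v :: l) => //=; rewrite sl.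
  by have [l sl /bound] := long n.+1; rewrite sl ltnn.
have flin : linear (@combination l).
  move=> c r s; rewrite /combination scaler_sumr -big_split; apply: eq_bigr => i _ /=.
  by rewrite !mxE scalerDl scalerA.
have finj : injective (@combination l).
  move=> r s rs; apply/eqP; rewrite -subr_eq0; apply/eqP.
  apply: combination_eq0 => //.
  by rewrite -scaleN1r addrC flin rs scaleN1r addNr.
exists (size l); constructor.
pose g v := projT1 (cid (spanned_combination (spanl v))).
have gK : cancel g (@combination l) by move=> v; rewrite /g; case: cid.
have fK : cancel (@combination l) g by move=> r; apply: finj; rewrite gK.
exists g; last by exists (@combination l).
by move=> c u v; apply: finj; rewrite gK flin !gK.
Qed.

End LinearSpan.

Section Rank.
Local Open Scope ring_scope.
Variable A : zmodType.

(** Clearing of denominators: up to an integer, elements of the tensor product with the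
    rationals come from [A]. *)
Lemma tensor_rat_fraction (u : tensor A rat) :
  exists2 m, (0 < m)%N & exists a, m%:R *: u = pure_tensor a (1 : rat).
Proof.
have pure0l (q : rat) : pure_tensor (0 : A) q = 0.
  by apply: (@addrI _ (pure_tensor 0 q)); rewrite -pure_tensorDl !addr0.
have pure0r (a : A) : pure_tensor a (0 : rat) = 0.
  by apply: (@addrI _ (pure_tensor a 0)); rewrite -pure_tensorDr !addr0.
have pureNl (a : A) (q : rat) : pure_tensor (- a) q = - pure_tensor a q.
  by apply/eqP; rewrite -addr_eq0 -pure_tensorDl addNr pure0l.
have pureNr (a : A) (q : rat) : pure_tensor a (- q) = - pure_tensor a q.
  by apply/eqP; rewrite -addr_eq0 -pure_tensorDr addNr pure0r.
have pureM (a : A) m : pure_tensor a (1 : rat) *+ m = pure_tensor (a *+ m) 1.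
  elim: m => [|m IH]; last by rewrite !mulrS IH pure_tensorDl.
  by rewrite !mulr0n pure0l.
have pureMr (a : A) m : pure_tensor a (m%:R : rat) = pure_tensor (a *+ m) 1.
  rewrite -pureM; elim: m => [|m IH]; first by rewrite !mulr0n pure0r.
  by rewrite !mulrS pure_tensorDr IH.
have pureMz (a : A) (m : int) : pure_tensor a (m%:~R : rat) = pure_tensor (a *~ m) 1.
  case: m => n; first by rewrite -!pmulrn pureMr.
  by rewrite NegzE !mulrNz -!pmulrn pureNl pureNr pureMr.
elim/tensorW: u => [|u v [m m0 [a ua]] [n n0 [b vb]]|a q].
- by exists 1%N => //; exists 0; rewrite scaler0 pure0l.
- exists (m * n)%N; first by rewrite muln_gt0 m0.
  exists (a *+ n - b *+ m); rewrite pure_tensorDl pureNl -!pureM -ua -vb.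
  by rewrite scalerBr natrM -!scaler_nat !scalerA mulrC.
- exists `|denq q|%N; first by rewrite absz_gt0 denq_eq0.
  exists (a *~ numq q); rewrite -pureMz.
  rewrite -[LHS]/(scale_tensor _ _) scale_pure; congr pure_tensor.
  by rewrite numqE mulrC pmulrn absz_denq.
Qed.
End Rank.

(** * The space of left-orderings *)

Section SpaceOfOrders.
Variable G : groupType.
Implicit Types (x y z g h f : G) (le : left_ordering G) (P R : G -> Prop).
Local Notation LO := (left_ordering G).

Lemma left_ordering_cone le : order_cone (fun x => le 1 x).
Proof.
split; first split=> [x y lx ly|x].
- by apply: (left_le_trans lx); rewrite -{1}[x]mulg1; exact: left_le_mul.
- have /orP [|lx] := left_le_total le 1 x; first by left.
  by right; have := left_le_mul x^-1 lx; rewrite mulVg mulg1.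
- move=> x lx lxV; apply/esym/(@left_le_anti _ le); rewrite lx /=.
  by have := left_le_mul x lxV; rewrite mulgV mulg1.
Qed.

Lemma left_orderingE le f g : le f g = le 1 (f^-1 * g).
Proof.
apply/idP/idP=> [/(left_le_mul f^-1)|/(left_le_mul f)]; by gsimp.
Qed.

Lemma left_ordering_ext (le1 le2 : LO) :
  (forall x, le1 1 x -> le2 1 x) -> le1 = le2.
Proof.
move=> sub.
have E : left_le le1 = left_le le2.
  apply/funext => f; apply/funext => g; rewrite left_orderingE [RHS]left_orderingE.
  apply/idP/idP; first exact: sub.
  have [[_ tot1] anti1] := left_ordering_cone le1.
  have [_ anti2] := left_ordering_cone le2.
  case: (tot1 (f^-1 * g)) => // le1V le2g.
  by rewrite (anti2 _ le2g (sub _ le1V)); have [] := tot1 1; rewrite ?invg1.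
case: le1 le2 E {sub} => r1 p1 p2 p3 p4 p5 [r2 q1 q2 q3 q4 q5] /= E.
by subst r2; congr LeftOrdering; exact: Prop_irrelevance.
Qed.

Section ConeOrder.
Variables (P : G -> Prop) (oP : order_cone P).
Let tP := oP.1.
Let r : rel G := fun f g => `[< P (f^-1 * g) >].

Lemma cone_order_refl : reflexive r.
Proof. by move=> x; apply/asboolP; rewrite mulVg; exact: cone1. Qed.
Lemma cone_order_anti : antisymmetric r.
Proof.
move=> x y /andP [/asboolP xy /asboolP yx].
have : (x^-1 * y) = 1 by apply: oP.2 => //; move: yx; gsimp.
by move/(congr1 ( *%g x)); gsimp.
Qed.
Lemma cone_order_trans : transitive r.
Proof.
move=> y x z /asboolP xy /asboolP yz; apply/asboolP.
by have := coneM tP xy yz; gsimp.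
Qed.
Lemma cone_order_total : total r.
Proof.
move=> x y; case: (tP) => _ /(_ (x^-1 * y)) [xy|xy].
  by apply/orP; left; apply/asboolP.
by apply/orP; right; apply/asboolP; move: xy; gsimp.
Qed.
Lemma cone_order_mul f g h : r f g -> r (h * f) (h * g).
Proof. by move=> /asboolP fg; apply/asboolP; move: fg; gsimp. Qed.

Definition cone_order : LO := LeftOrdering cone_order_refl cone_order_anti
  cone_order_trans cone_order_total cone_order_mul.

Lemma cone_orderE x : cone_order 1 x <-> P x.
Proof.
by split=> [/asboolP|Px]; [|apply/asboolP]; rewrite invg1 mul1g.
Qed.
End ConeOrder.

Lemma complete_cone P R : order_cone P -> total_cone R ->
  order_cone (fun x => ~ R x^-1 \/ (null R x /\ P x)).
Proof.
move=> [tP aP] tR; split; first split.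
- move=> x y [xV|[Sx Px]] [yV|[Sy Py]].
  + by left; apply: (cone_sposM tR) => //; exact: coneNV.
  + by left; apply: (cone_sposMl tR xV Sy.1).
  + by left; apply: (cone_sposM tR Sx.1 yV).
  + by right; split; [exact: (subM (null_subgroup tR))|exact: coneM].
- move=> x; case: (pselect (R x^-1)) => xV; last by left; left.
  case: (pselect (R x)) => Rx; last by right; left; rewrite invgK.
  by case: (tP) => _ /(_ x) [Px|Px]; [left|right]; right; split=> //; split; rewrite ?invgK.
- move=> x [xV|[Sx Px]] [xV'|[SxV PxV]].
  + by exfalso; apply: xV; rewrite invgK in xV'; exact: coneN.
  + by exfalso; apply: xV; case: SxV.
  + by exfalso; apply: xV'; rewrite invgK; case: Sx.
  + exact: aP.
Qed.

Lemma open_singleton_isolated le : open [set le] ->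
  exists F : seq G, isolated_by (fun x => le 1 x) F.
Proof.
move=> [D _ DE].
have [F DF leF] : exists2 F, D F & basic_open F le.
  have : (\bigcup_(i in D) basic_open i) le by rewrite DE.
  by case=> F DF leF; exists F.
have sub le' : basic_open F le' -> le' = le.
  move=> Fle'; have : [set le] le' by rewrite -DE; exists F.
  by [].
exists (enum_fset F); split; first exact: left_ordering_cone.
  by move=> f fF; exact: leF.
move=> R tR FR x lx.
have oR := complete_cone (left_ordering_cone le) tR.
have E : cone_order oR = le.
  apply: sub => f fF; apply/(cone_orderE oR).
  case: (pselect (R f^-1)) => fV; [right|by left].
  by split; [split=> //; exact: FR|exact: leF].
have /(cone_orderE oR) [xV|[[Rx _] _]] : cone_order oR 1 x by rewrite E.
  exact: coneNV.
by [].
Qed.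

Lemma basic_open_nbhs (F : {fset G}) le : basic_open F le -> nbhs le (basic_open F).
Proof.
move=> leF; apply: open_nbhs_nbhs; split=> //.
by exists [set F] => //; rewrite bigcup_set1.
Qed.

Lemma nbhs_basic_open le (A : set LO) : nbhs le A ->
  exists2 F : {fset G}, basic_open F le & basic_open F `<=` A.
Proof.
rewrite nbhsE => -[B [[D _ DE] Ble] BA].
move: Ble; rewrite -DE => -[F DF leF]; exists F => // l lF; apply: BA.
by rewrite -DE; exists F.
Qed.

(** An ultrafilter of orders converges to the order in which [x] is positive whenever
    almost all orders say so. *)
Lemma compact_orders : compact [set: LO].
Proof.
rewrite compact_ultra => U UU _.
pose P x := U [set le : LO | le 1 x].
have oP : order_cone P.
  split; first split=> [x y Px Py|x].
  - apply: filterS (filterI Px Py) => le [/= lx ly].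
    exact: (coneM (left_ordering_cone le).1 lx ly).
  - case: (in_ultra_setVsetC [set le : LO | le 1 x] UU) => Ux; [by left|right].
    apply: filterS Ux => le /= lx.
    exact: (coneN (left_ordering_cone le).1 lx).
  - move=> x Px PxV; have [le [/= lx lxV]] := filter_ex (filterI Px PxV).
    by have [_ anti] := left_ordering_cone le; exact: anti.
exists (cone_order oP); split=> // A /nbhs_basic_open [F PF FA].
apply: (filterS FA); rewrite /basic_open.
have -> : [set le : LO | forall f, f \in F -> le 1 f] =
    \bigcap_(f in [set` F]) [set le : LO | le 1 f].
  by apply/seteqP; split=> le /= H f; exact: H.
by apply: filter_bigI => f fF; apply/(cone_orderE oP); exact: PF.
Qed.

Lemma nbhs_same_sign le x : nbhs le [set l : LO | l 1 x = le 1 x].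
Proof.
case lx : (le 1 x).
  have : basic_open [fset x]%fset le by move=> f /fset1P ->.
  move=> /basic_open_nbhs; apply: filterS => l; apply; exact: fset11.
have [tle _] := left_ordering_cone le.
have lxV : le 1 x^-1 by apply: (coneN tle); rewrite lx.
have : basic_open [fset x^-1]%fset le by move=> f /fset1P ->.
move=> /basic_open_nbhs; apply: filterS => l lV /=; apply/negP => l1.
have [_ anti] := left_ordering_cone l.
have x1 := anti x l1 (lV _ (fset11 _)).
by move: lx; rewrite x1 left_le_refl.
Qed.

End SpaceOfOrders.

Section Metrize.
Variables (G : groupType) (e : nat -> G) (le0 : left_ordering G).
Local Notation LO := (left_ordering G).

Definition signs (le : LO) : prod_topology (fun _ : nat => discrete_topology bool) :=
  fun n => le 1 (e n).

(** The same set of orders, with the topology induced by the signs of the elements that [e]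
    enumerates.  This presentation provides a pseudometric, and the topology is proved
    below to be the given one. *)
Definition sign_space of left_ordering G : Type := initial_topology signs.

Local Notation W := (sign_space le0).

HB.instance Definition _ := Uniform.on W.
HB.instance Definition _ := isPointed.Build W le0.
HB.instance Definition _ (R : realType) : @PseudoMetric R W :=
  PseudoMetric.on W.

Hypothesis e_surj : forall x, exists n, e n = x.

Lemma signs_continuous : continuous signs.
Proof.
move=> le; have FF : Filter (signs @ nbhs le) by apply: fmap_filter; exact: nbhs_filter.
apply/cvg_sup => n U [V] [[B] oB <-] BlE BU.
apply: (filterS BU); rewrite nbhs_simpl.
by apply: filterS (nbhs_same_sign le (e n)) => l /= lE; rewrite /signs /= lE.
Qed.

Lemma to_sign_space_continuous : continuous (id : LO -> W).
Proof. exact/continuous_comp_initial/signs_continuous. Qed.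

Lemma clopen_sign x : clopen [set l : W | (l : LO) 1 x].
Proof.
have [n <-] := e_surj x.
have -> : [set l : W | (l : LO) 1 (e n)] =
    signs @^-1` (@proj _ (fun=> discrete_topology bool) n @^-1` [set true]).
  by apply/seteqP; split=> l.
apply: preimage_clopen; last exact: initial_continuous.
apply: preimage_clopen; last exact: proj_continuous.
by split; [exact: discrete_open|exact: discrete_closed].
Qed.

Lemma from_sign_space_continuous : continuous (id : W -> LO).
Proof.
move=> le A /nbhs_basic_open [F leF FA].
suff : nbhs (le : W) (basic_open F : set W) by apply: filterS.
have -> : basic_open F = \bigcap_(f in [set` F]) [set l : W | (l : LO) 1 f].
  by apply/seteqP; split=> l /= H f; exact: H.
apply: filter_bigI => f fF; apply: open_nbhs_nbhs; split; last exact: leF.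
by case: (clopen_sign f).
Qed.

Lemma sign_space_cantor_like : (forall le : LO, ~ open [set le]) -> cantor_like W.
Proof.
move=> no_isolated.
have zdW : zero_dimensional W.
  move=> l1 l2 l12.
  have [x l1x l2x] : exists2 x, (l1 : LO) 1 x & ~ (l2 : LO) 1 x.
    apply: contrapT => nx; move/eqP: l12; apply; apply: left_ordering_ext => x lx.
    by apply: contrapT => l2x; apply: nx; exists x.
  by exists [set l : W | (l : LO) 1 x]; split=> //; exact: clopen_sign.
split=> //.
- apply/perfectTP => le ole; apply: (no_isolated le).
  by move/continuousP : to_sign_space_continuous => /(_ _ ole).
- have := @continuous_compact LO W id [set: LO] _ (@compact_orders G).
  rewrite image_id; apply.
  exact/continuous_subspaceT/to_sign_space_continuous.
- rewrite open_hausdorff => l1 l2 /zdW [U [[oU cU] Ul1 Ul2]].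
  exists (U, ~` U); rewrite ?inE//; split=> //=; first by rewrite openC.
  by rewrite setICr.
Qed.

End Metrize.

(** The homeomorphism with the Cantor space is that of the characterization of
    compact, perfect, zero-dimensional metrizable spaces.  The field of real numbers is chosen
    only to express metrizability. *)
Lemma homeomorphic_cantor (G : groupType) : countable [set: G] ->
  left_orderable G -> (forall le : left_ordering G, ~ open [set le]) ->
  homeomorphic (left_ordering G) cantor_space.
Proof.
move=> Gcount [le0] no_isolated.
have [e e_surj] : exists e : nat -> G, forall x, exists n, e n = x.
  have /countable_injP [f /in2TT finj] := Gcount.
  exists (fun n => xget 1 [set x | f x = n]) => x; exists (f x).
  by apply: finj; case: xgetP => // /(_ x) [].
pose W := sign_space e le0.
have [f [fc fcl]] := @homeomorphism_cantor_like Rdefinitions.R W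
  (sign_space_cantor_like le0 e_surj no_isolated).
have fK : cancel f f^-1%FUN by move=> x; rewrite funK ?inE.
have fVK : cancel f^-1%FUN f by move=> x; rewrite invK ?inE.
have fVc : continuous (f^-1%FUN : W -> cantor_space).
  apply/continuous_closedP => A cA.
  have -> : f^-1%FUN @^-1` A = f @` A; last exact: fcl.
  apply/seteqP; split=> [x Ax|_ [y Ay <-]]; last by rewrite /preimage /= fK.
  by exists (f^-1%FUN x) => //; rewrite fVK.
exists (f^-1%FUN : W -> cantor_space), (f : cantor_space -> W); split=> //.
- move=> le; apply: (@continuous_comp (left_ordering G) W cantor_space id); last exact: fVc.
  exact: to_sign_space_continuous.
- move=> c; apply: (@continuous_comp cantor_space W (left_ordering G) f id); first exact: fc.
  exact: from_sign_space_continuous.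
Qed.

(** * Groups with an isolated ordering have finite rank *)

Section AbelianizationRank.
Variables (G : groupType) (K : groupClosed G).
Local Notation A := (abelianization K).

Definition class_tensor (h : sub_of K) : tensor A rat :=
  pure_tensor (\pi_A h : A) (1%R : rat).

Lemma class_tensorM h k :
  class_tensor (h * k) = (class_tensor h + class_tensor k)%R.
Proof.
have hk : (\pi_A (h * k) : A) = ((\pi_A h : A) + (\pi_A k : A))%R.
  by rewrite -[RHS]/(abel_add _ _) pi_abel_add.
by rewrite /class_tensor hk pure_tensorDl.
Qed.

Lemma class_tensor1 : class_tensor 1 = 0%R.
Proof.
by apply: (@addrI _ (class_tensor 1)); rewrite -class_tensorM mulg1 addr0.
Qed.

Lemma class_tensorV h : class_tensor h^-1 = (- class_tensor h)%R.
Proof.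
by apply/eqP; rewrite -addr_eq0 -class_tensorM mulVg class_tensor1.
Qed.

Lemma class_tensorX h m : class_tensor (h ^+ m) = (m%:R *: class_tensor h)%R.
Proof.
rewrite scaler_nat; elim: m => [|m IH]; first by rewrite mulr0n class_tensor1.
by rewrite expgS class_tensorM IH mulrS.
Qed.

(** For an independent list [l], the elements of [K] whose classes are spanned by a
    tail of [l] form a chain above the derived subgroup.  No step is torsion: a
    multiple of each vector of [l] is the class of some element of [K], and no power of that
    element is spanned by the following vectors. *)
Lemma abelianization_finite_rank n :
  chain_length (fun _ : G => True) n -> finite_rank A.
Proof.
move=> chG; apply: (@finite_dim_independent _ _ n) => l indl.
rewrite leqNgt; apply/negP => nl.
pose L i x := exists2 h : sub_of K, val h = x & spanned (drop i l) (class_tensor h).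
have spanN i u : spanned (drop i l) u -> spanned (drop i l) (- u)%R.
  by move=> Su; rewrite -sub0r; apply: spannedB => //; exact: spanned0.
have indrop i : independent (drop i l).
  by elim: i {L spanN nl} l indl => [|i IH] [|w l] //= [_ /IH].
have [||||i lin tors] := chG L.
- move=> i; split=> [|_ _ [h <- Sh] [k <- Sk]|_ [h <- Sh]].
  + by exists 1; rewrite ?val1 // class_tensor1; exact: spanned0.
  + exists (h * k); first by rewrite valM.
    by rewrite class_tensorM -[class_tensor k]opprK; apply: spannedB => //; exact: spanN.
  + by exists h^-1; [exact: gmulfV|rewrite class_tensorV; exact: spanN].
- move=> i _ [h <- Sh]; exists h => //.
  case: (ltnP i (size l)) => il; last first.
    by rewrite drop_oversize //; rewrite drop_oversize // in Sh; exact: leqW.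
  by rewrite (drop_nth 0%R il); exact: spanned_cons.
- by [].
- move=> _ _ [h <- _] [k <- _]; exists (h * k * h^-1 * k^-1).
    by rewrite !valM !gmulfV.
  by rewrite !(class_tensorM, class_tensorV) addrAC addrK subrr; exact: spanned0.
have il : (i < size l)%N by exact: ltn_trans nl.
have := indrop i; rewrite (drop_nth 0%R il) /= => -[+ _]; apply.
have [m m0 [a va]] := tensor_rat_fraction (l`_i)%R.
move: va; rewrite -[a]reprK => va.
have [|d d0 [h' hE Sh']] := tors (val (repr a)).
  exists (repr a) => //; rewrite /class_tensor -va (drop_nth 0%R il).
  by apply: spannedZ; exact: spanned_mem_head.
have {}hE : h' = repr a ^+ d by apply: val_inj; rewrite hE -gmulfXn.
move: Sh'; rewrite hE class_tensorX /class_tensor -va => Sh'.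
have := spannedZ (m%:R^-1 / d%:R)%R Sh'; rewrite !scalerA.
by rewrite (mulfVK _ m%:R^-1)%R ?mulVf ?scale1r // Num.Theory.pnatr_eq0 -lt0n.
Qed.

End AbelianizationRank.

Theorem corollary1p2 (G : groupType) (Gcount : countable [set: G])
    (Glo : left_orderable G) (Gvs : virtually_solvable G)
    (Ginf : infinite_rank G) :
  homeomorphic (left_ordering G) cantor_space.
Proof.
apply: homeomorphic_cantor => // le /open_singleton_isolated [F iF].
have [H [fiH solH]] := Ginf; apply => k.
have [_ _ [n chG]] := isolated_structure iF (derived_core_series fiH solH).
exact: abelianization_finite_rank chG.
Qed.
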